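(* Let $H$ be a Hopf algebra over $\mathbb{C}$ and let $A\subset H$ be a normal Hopf subalgebra. Assume that: (1) $A$ is inner linear and commutative; (2) $H$ is finitely generated as a right $A$-module. Then $H$ is inner linear.
   Context: All Hopf algebras are over $\mathbb{C}$. A Hopf ideal is a two-sided ideal $I$ of a Hopf algebra $H$ with $\Delta(I)\subset I\otimes H+H\otimes I$, $\varepsilon(I)=0$, $S(I)\subset I$. A Hopf algebra is inner linear if it contains a (two-sided) ideal of finite codimension that does not contain any non-zero Hopf ideal. A Hopf subalgebra $A\subset H$ is normal if it is stable under the left and right adjoint actions of $H$ on itself, $\mathrm{ad}_l(x)(y)=x_{(1)}yS(x_{(2)})$ and $\mathrm{ad}_r(x)(y)=S(x_{(1)})yx_{(2)}$, $x,y\in H$ (Sweedler notation). *)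

(* Defs.v *)
From HB Require Import structures.
From mathcomp Require Import all_boot all_order all_algebra.
From mathcomp Require Import sesquilinear complex.
From mathcomp Require Import boolp classical_sets reals.

Set Implicit Arguments.
Unset Strict Implicit.
Unset Printing Implicit Defensive.

Import GRing.Theory.
Local Open Scope ring_scope.
Local Open Scope classical_set_scope.
Local Open Scope quotient_scope.

Reserved Notation "u \ox v" (at level 40, left associativity).

(* [tensor U V] is U (x)_K V by generators and relations: a list stands for
   the sum of the pure tensors that it contains. *)

Section TensorSpace.
Variables (K : fieldType) (U V : lmodType K).
Implicit Types s t : seq (U * V).

Inductive tensor_rel : seq (U * V) -> seq (U * V) -> Prop :=
| tensor_refl s : tensor_rel s s
| tensor_sym s t : tensor_rel s t -> tensor_rel t s
| tensor_trans s t r : tensor_rel s t -> tensor_rel t r -> tensor_rel s r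
| tensor_cat s s' t t' :
    tensor_rel s s' -> tensor_rel t t' -> tensor_rel (s ++ t) (s' ++ t')
| tensor_catC s t : tensor_rel (s ++ t) (t ++ s)
| tensor_0l v : tensor_rel [:: (0, v)] [::]
| tensor_Dl u u' v : tensor_rel [:: (u + u', v)] [:: (u, v); (u', v)]
| tensor_Dr u v v' : tensor_rel [:: (u, v + v')] [:: (u, v); (u, v')]
| tensor_Z a u v : tensor_rel [:: (a *: u, v)] [:: (u, a *: v)].

Definition tensor_relb : rel (seq (U * V)) := fun s t => `[< tensor_rel s t >].

Lemma tensor_relb_refl : reflexive tensor_relb.
Proof. by move=> s; apply/asboolP; exact: tensor_refl. Qed.

Lemma tensor_relb_sym : symmetric tensor_relb.
Proof. by move=> s t; apply/asboolP/asboolP; exact: tensor_sym. Qed.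

Lemma tensor_relb_trans : transitive tensor_relb.
Proof.
by move=> t s r /asboolP st /asboolP tr; apply/asboolP; exact: tensor_trans tr.
Qed.

Canonical tensor_equiv :=
  EquivRel tensor_relb tensor_relb_refl tensor_relb_sym tensor_relb_trans.

Definition tensor := {eq_quot tensor_equiv}.
HB.instance Definition _ := Choice.on tensor.
HB.instance Definition _ : EqQuotient _ tensor_equiv tensor :=
  EqQuotient.on tensor.

Lemma tensor_piP s t : tensor_rel s t <-> \pi_tensor s = \pi_tensor t.
Proof.
split=> [st|]; first by apply/eqmodP/asboolP.
by move=> /eqmodP /asboolP.
Qed.

Lemma tensor_reprK s : tensor_rel (repr (\pi_tensor s)) s.
Proof. by apply/tensor_piP; rewrite reprK. Qed.

Let addt (x y : tensor) : tensor := \pi_tensor (repr x ++ repr y).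
Let oppt (x : tensor) : tensor :=
  \pi_tensor [seq (- p.1, p.2) | p <- repr x].
Let scalet (a : K) (x : tensor) : tensor :=
  \pi_tensor [seq (a *: p.1, p.2) | p <- repr x].

Let addt_pi s t : addt (\pi_tensor s) (\pi_tensor t) = \pi_tensor (s ++ t).
Proof. by apply/tensor_piP; apply: tensor_cat; exact: tensor_reprK. Qed.

Let rel_scale a s t : tensor_rel s t ->
  tensor_rel [seq (a *: p.1, p.2) | p <- s] [seq (a *: p.1, p.2) | p <- t].
Proof.
elim=> {s t} /=.
- by move=> s; exact: tensor_refl.
- by move=> s t _; exact: tensor_sym.
- by move=> s t r _ st _; exact: tensor_trans.
- by move=> s s' t t' _ ss' _ tt'; rewrite !map_cat; exact: tensor_cat.
- by move=> s t; rewrite !map_cat; exact: tensor_catC.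
- by move=> v; rewrite scaler0; exact: tensor_0l.
- by move=> u u' v; rewrite scalerDr; exact: tensor_Dl.
- by move=> u v v'; exact: tensor_Dr.
- move=> b u v; rewrite scalerA mulrC -scalerA; exact: tensor_Z.
Qed.

Let scalet_pi a s :
  scalet a (\pi_tensor s) = \pi_tensor [seq (a *: p.1, p.2) | p <- s].
Proof. by apply/tensor_piP; apply: rel_scale; exact: tensor_reprK. Qed.

Let tensor_ind (P : tensor -> Prop) : (forall s, P (\pi_tensor s)) ->
  forall x, P x.
Proof. by move=> h x; rewrite -[x]reprK; exact: h. Qed.

Let addtA : associative addt.
Proof.
move=> x y z; elim/tensor_ind: x => s; elim/tensor_ind: y => t.
by elim/tensor_ind: z => r; rewrite !addt_pi catA.
Qed.

Let addtC : commutative addt.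
Proof.
move=> x y; elim/tensor_ind: x => s; elim/tensor_ind: y => t.
by rewrite !addt_pi; apply/tensor_piP; exact: tensor_catC.
Qed.

Let add0t : left_id (\pi_tensor [::]) addt.
Proof. by move=> x; elim/tensor_ind: x => s; rewrite addt_pi. Qed.

Let rel_lin (f g h : U -> U) s : (forall u, f u = g u + h u) ->
  tensor_rel [seq (f p.1, p.2) | p <- s]
             ([seq (g p.1, p.2) | p <- s] ++ [seq (h p.1, p.2) | p <- s]).
Proof.
move=> fgh; elim: s => [|[u v] s IHs] /=; first exact: tensor_refl.
rewrite -cat1s fgh; apply: tensor_trans (tensor_cat (tensor_Dl _ _ _) IHs) _.
rewrite -[X in tensor_rel X _]/([:: (g u, v)] ++ ([:: (h u, v)] ++ _ ++ _)).
rewrite -[X in tensor_rel _ X]cat1s; apply: tensor_cat (tensor_refl _) _.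
rewrite catA -[X in tensor_rel _ X]/(_ ++ ([:: (h u, v)] ++ _)) [X in tensor_rel _ X]catA.
by apply: tensor_cat (tensor_catC _ _) (tensor_refl _).
Qed.

Let rel_null s : tensor_rel [seq (0 : U, p.2) | p <- s] [::].
Proof.
elim: s => [|[u v] s IHs] /=; first exact: tensor_refl.
by rewrite -cat1s; exact: (tensor_cat (tensor_0l v) IHs).
Qed.

Let opptE x : oppt x = scalet (-1) x.
Proof. by congr (\pi_tensor _); apply: eq_map => p; rewrite scaleN1r. Qed.

Let addNt : left_inverse (\pi_tensor [::]) oppt addt.
Proof.
move=> x; rewrite opptE; elim/tensor_ind: x => s; rewrite scalet_pi addt_pi.
apply/tensor_piP; apply: tensor_trans (rel_null s).
apply: tensor_sym.
have e : [seq (id p.1, p.2) | p <- s] = s by elim: s => [|[? ?] ? /= ->].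
have := @rel_lin (fun=> 0) ( *:%R (-1)) id s; rewrite e; apply=> u.
by rewrite scaleN1r addNr.
Qed.

HB.instance Definition _ :=
  GRing.isZmodule.Build tensor addtA addtC add0t addNt.

Let scaletA a b x : scalet a (scalet b x) = scalet (a * b) x.
Proof.
elim/tensor_ind: x => s; rewrite !scalet_pi -map_comp.
by congr (\pi_tensor _); apply: eq_map => p /=; rewrite scalerA.
Qed.

Let scale1t : left_id 1 scalet.
Proof.
move=> x; elim/tensor_ind: x => s; rewrite scalet_pi; congr (\pi_tensor _).
by elim: s => [|[u v] s /= ->] //; rewrite scale1r.
Qed.

Let scaletDr : right_distributive scalet +%R.
Proof.
move=> a x y; elim/tensor_ind: x => s; elim/tensor_ind: y => t.
by rewrite [_ + _]addt_pi !scalet_pi [RHS]addt_pi map_cat.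
Qed.

Let scaletDl x : {morph scalet^~ x : a b / a + b}.
Proof.
move=> a b; elim/tensor_ind: x => s /=; rewrite !scalet_pi [RHS]addt_pi.
by apply/tensor_piP; apply: rel_lin => u; rewrite scalerDl.
Qed.

HB.instance Definition _ := GRing.Zmodule_isLmodule.Build K tensor
  scaletA scale1t scaletDr scaletDl.

Definition pure_tensor (u : U) (v : V) : tensor := \pi_tensor [:: (u, v)].

Lemma tensor_pi_sum s :
  \pi_tensor s = \sum_(p <- s) pure_tensor p.1 p.2 :> tensor.
Proof.
elim: s => [|[u v] s IHs]; first by rewrite big_nil.
by rewrite big_cons -IHs [RHS]addt_pi.
Qed.

Lemma pure_tensor_bilinear : bilinear_for *:%R *:%R pure_tensor.
Proof.
split=> [v a x y|u a x y]/=.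
  rewrite [X in _ = X + _]scalet_pi /= [RHS]addt_pi; apply/tensor_piP.
  exact: tensor_Dl.
rewrite [X in _ = X + _]scalet_pi /= [RHS]addt_pi; apply/tensor_piP.
apply: tensor_trans (tensor_Dr _ _ _) _.
by apply: (tensor_cat (tensor_sym (tensor_Z _ _ _)) (tensor_refl _)).
Qed.

(* The linear map induced by [f]; junk when [f] is not bilinear. *)
Definition tensor_lift (W : lmodType K) (f : U -> V -> W) (x : tensor) : W :=
  \sum_(p <- repr x) f p.1 p.2.

Section Lift.
Variables (W : lmodType K) (f : U -> V -> W).
Hypothesis f_bilin : bilinear_for *:%R *:%R f.

Let fDl u u' v : f (u + u') v = f u v + f u' v.
Proof. by have := f_bilin.1 v 1 u u'; rewrite /= !scale1r. Qed.

Let fDr u v v' : f u (v + v') = f u v + f u v'.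
Proof. by have := f_bilin.2 u 1 v v'; rewrite /= !scale1r. Qed.

Let f0l v : f 0 v = 0.
Proof. by apply: (addrI (f 0 v)); rewrite -fDl !addr0. Qed.

Let f0r u : f u 0 = 0.
Proof. by apply: (addrI (f u 0)); rewrite -fDr !addr0. Qed.

Let fZl a u v : f (a *: u) v = a *: f u v.
Proof. by have := f_bilin.1 v a u 0; rewrite /= f0l !addr0. Qed.

Let fZr a u v : f u (a *: v) = a *: f u v.
Proof. by have := f_bilin.2 u a v 0; rewrite /= f0r !addr0. Qed.

Let rel_sum s t : tensor_rel s t ->
  \sum_(p <- s) f p.1 p.2 = \sum_(p <- t) f p.1 p.2.
Proof.
elim=> {s t} //=.
- by move=> s t r _ -> _ ->.
- by move=> s s' t t' _ ss' _ tt'; rewrite !big_cat ss' tt'.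
- by move=> s t; rewrite !big_cat /= addrC.
- by move=> v; rewrite big_cons !big_nil f0l addr0.
- by move=> u u' v; rewrite !big_cons !big_nil !addr0 fDl.
- by move=> u v v'; rewrite !big_cons !big_nil !addr0 fDr.
- by move=> a u v; rewrite !big_cons !big_nil fZl fZr.
Qed.

Let tensor_lift_pi s :
  tensor_lift f (\pi_tensor s) = \sum_(p <- s) f p.1 p.2.
Proof. by apply: rel_sum; exact: tensor_reprK. Qed.

Lemma tensor_liftE u v : tensor_lift f (pure_tensor u v) = f u v.
Proof. by rewrite [LHS](tensor_lift_pi [:: (u, v)]) big_cons big_nil addr0. Qed.

Lemma tensor_lift_linear : linear (tensor_lift f).
Proof.
move=> a x y; elim/tensor_ind: x => s; elim/tensor_ind: y => t.
rewrite [X in tensor_lift f (X + _)]scalet_pi [X in tensor_lift f X]addt_pi.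
rewrite !tensor_lift_pi.
rewrite big_cat big_map /= scaler_sumr; congr (_ + _).
by apply: eq_bigr => p _; rewrite fZl.
Qed.

End Lift.

Lemma tensor_spanP (x : tensor) :
  exists s : seq (U * V), x = \sum_(p <- s) pure_tensor p.1 p.2.
Proof. by exists (repr x); rewrite -tensor_pi_sum reprK. Qed.

End TensorSpace.

Notation "u \ox v" := (pure_tensor u v) : ring_scope.

Section TensorTheory.
Variable K : fieldType.

Lemma pure_tensorDl (U V : lmodType K) (u u' : U) (v : V) :
  (u + u') \ox v = u \ox v + u' \ox v.
Proof.
by have := (pure_tensor_bilinear U V).1 v 1 u u'; rewrite /= !scale1r.
Qed.

Lemma pure_tensorDr (U V : lmodType K) (u : U) (v v' : V) :
  u \ox (v + v') = u \ox v + u \ox v'.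
Proof.
by have := (pure_tensor_bilinear U V).2 u 1 v v'; rewrite /= !scale1r.
Qed.

Lemma pure_tensorZl (U V : lmodType K) a (u : U) (v : V) :
  (a *: u) \ox v = a *: (u \ox v).
Proof.
have e0 : (0 : U) \ox v = 0.
  by apply: (addrI (0 \ox v)); rewrite -pure_tensorDl !addr0.
have := (pure_tensor_bilinear U V).1 v a u 0.
by rewrite /= e0 !addr0.
Qed.

Lemma pure_tensorZr (U V : lmodType K) a (u : U) (v : V) :
  u \ox (a *: v) = a *: (u \ox v).
Proof.
have e0 : u \ox (0 : V) = 0.
  by apply: (addrI (u \ox 0)); rewrite -pure_tensorDr !addr0.
have := (pure_tensor_bilinear U V).2 u a v 0.
by rewrite /= e0 !addr0.
Qed.

Lemma tensor_lin_ext (U V W : lmodType K) (f g : tensor U V -> W) :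
  linear f -> linear g -> (forall u v, f (u \ox v) = g (u \ox v)) -> f =1 g.
Proof.
move=> lf lg fg x; have [s ->] := tensor_spanP x.
have lin0 (h : tensor U V -> W) : linear h -> h 0 = 0.
  move=> lh; have := lh 1 0 0; rewrite !scale1r !addr0 => e.
  by apply: (addrI (h 0)); rewrite addr0.
elim: s => [|p s IHs]; first by rewrite big_nil !lin0.
by rewrite big_cons -[X in X + _]scale1r lf lg IHs fg.
Qed.

Definition tensor_map (U V U' V' : lmodType K) (f : U -> U') (g : V -> V') :
    tensor U V -> tensor U' V' :=
  tensor_lift (fun u v => f u \ox g v).

Definition tensor_assoc (U V W : lmodType K) :
    tensor (tensor U V) W -> tensor U (tensor V W) :=
  tensor_lift (fun x w => tensor_lift (fun u v => u \ox (v \ox w)) x).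

End TensorTheory.

Section TensorAlgebra.
Variables (K : fieldType) (A B : algType K).
Implicit Types x y z : tensor A B.

Definition tensor_mul x y : tensor A B :=
  tensor_lift
    (fun a b => tensor_lift (fun a' b' => (a * a') \ox (b * b')) y) x.

Let mul_in (a : A) (b : B) :
  bilinear_for *:%R *:%R (fun a' b' => (a * a') \ox (b * b')).
Proof.
split=> [b' c u v|a' c u v]; rewrite /= mulrDr -scalerAr.
  by rewrite pure_tensorDl pure_tensorZl.
by rewrite pure_tensorDr pure_tensorZr.
Qed.

Let mul_out y : bilinear_for *:%R *:%R
  (fun a b => tensor_lift (fun a' b' => (a * a') \ox (b * b')) y).
Proof.
split=> [b c u v|a c u v]; rewrite /= /tensor_lift scaler_sumr
  -big_split; apply: eq_bigr => p _ /=; rewrite mulrDl -scalerAl.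
  by rewrite pure_tensorDl pure_tensorZl.
by rewrite pure_tensorDr pure_tensorZr.
Qed.

Lemma tensor_mulE (a a' : A) (b b' : B) :
  tensor_mul (a \ox b) (a' \ox b') = (a * a') \ox (b * b').
Proof. by rewrite /tensor_mul !tensor_liftE. Qed.

Let mul_linl y : linear (tensor_mul^~ y).
Proof. exact: tensor_lift_linear. Qed.

Let mul_linr x : linear (tensor_mul x).
Proof.
move=> c y z; rewrite /tensor_mul /tensor_lift -/(tensor_lift _ _).
rewrite scaler_sumr -big_split; apply: eq_bigr => p _ /=.
exact: (tensor_lift_linear (mul_in _ _)).
Qed.

Let mul_Dl : left_distributive tensor_mul +%R.
Proof. by move=> x y z; have := mul_linl z 1 x y; rewrite /= !scale1r. Qed.

Let mul_Dr : right_distributive tensor_mul +%R.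
Proof. by move=> x y z; have := mul_linr x 1 y z; rewrite /= !scale1r. Qed.

Let mul_A : associative tensor_mul.
Proof.
move=> x y z.
apply: (tensor_lin_ext (f := fun x => tensor_mul x (tensor_mul y z))
  (g := fun x => tensor_mul (tensor_mul x y) z)) => [||a b].
- exact: mul_linl.
- by move=> c u v; rewrite !mul_linl.
apply: (tensor_lin_ext (f := fun y => tensor_mul _ (tensor_mul y z))
  (g := fun y => tensor_mul (tensor_mul _ y) z)) => [||a' b'].
- by move=> c u v; rewrite mul_linl mul_linr.
- by move=> c u v; rewrite mul_linr mul_linl.
apply: (tensor_lin_ext (f := fun z => tensor_mul _ (tensor_mul _ z))
  (g := fun z => tensor_mul (tensor_mul _ _) z)) => [||a2 b2].
- by move=> c u v; rewrite !mul_linr.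
- by move=> c u v; rewrite mul_linr.
by rewrite !tensor_mulE !mulrA.
Qed.

Let mul_1l : left_id (1 \ox 1) tensor_mul.
Proof.
apply: tensor_lin_ext => [||a b]; first exact: mul_linr.
  by [].
by rewrite tensor_mulE !mul1r.
Qed.

Let mul_1r : right_id (1 \ox 1) tensor_mul.
Proof.
apply: (tensor_lin_ext (f := tensor_mul^~ _)) => [||a b].
- exact: mul_linl.
- by [].
by rewrite tensor_mulE !mulr1.
Qed.

HB.instance Definition _ := GRing.Zmodule_isPzRing.Build (tensor A B)
  mul_A mul_1l mul_1r mul_Dl mul_Dr.

Lemma tensor_mul_pure (a a' : A) (b b' : B) :
  (a \ox b) * (a' \ox b') = (a * a') \ox (b * b').
Proof. exact: tensor_mulE. Qed.

Lemma tensor_one : 1 = 1 \ox 1 :> tensor A B.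
Proof. by []. Qed.

End TensorAlgebra.

HB.mixin Record Algebra_isHopf (K : fieldType) H of GRing.Algebra K H := {
  comul : H -> tensor H H;
  counit : {lrmorphism H -> K | *%R};
  antipode : {linear H -> H};
  comul_linear : linear comul;
  comul_monoid_morphism : monoid_morphism comul;
  comulA : forall x : H,
    tensor_assoc (tensor_map comul idfun (comul x)) =
    tensor_map idfun comul (comul x);
  counitl : forall x : H,
    tensor_lift (fun a b : H => counit a *: b) (comul x) = x;
  counitr : forall x : H,
    tensor_lift (fun a b : H => counit b *: a) (comul x) = x;
  antipodel : forall x : H,
    tensor_lift (fun a b : H => antipode a * b) (comul x) = (counit x)%:A;
  antipoder : forall x : H,
    tensor_lift (fun a b : H => a * antipode b) (comul x) = (counit x)%:A
}.

#[short(type="hopfAlgType")]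
HB.structure Definition HopfAlgebra (K : fieldType) :=
  {H of Algebra_isHopf K H & GRing.Algebra K H}.

HB.instance Definition _ (K : fieldType) (H : hopfAlgType K) :=
  GRing.isLinear.Build K H (tensor H H) _ (@comul K H) (@comul_linear K H).
HB.instance Definition _ (K : fieldType) (H : hopfAlgType K) :=
  GRing.isMonoidMorphism.Build H (tensor H H) (@comul K H)
    (@comul_monoid_morphism K H).

Section HopfNotions.
Variables (K : fieldType) (H : hopfAlgType K).

Definition two_sided_ideal (I : set H) : Prop :=
  [/\ I 0,
      forall x y, I x -> I y -> I (x + y) &
      forall h x, I x -> I (h * x) /\ I (x * h)].

Definition finite_codim (I : set H) : Prop :=
  exists (n : nat) (e : 'I_n -> H), forall h : H,
    exists c : 'I_n -> K, I (h - \sum_(i < n) c i *: e i).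

(* The subspace P (x) Q of H (x) H, for subspaces P and Q of H. *)
Definition tensor_sub (P Q : set H) : set (tensor H H) :=
  [set z | exists2 s : seq (H * H),
     forall p, p \in s -> P p.1 /\ Q p.2 &
     z = \sum_(p <- s) p.1 \ox p.2].

Definition hopf_ideal (I : set H) : Prop :=
  [/\ two_sided_ideal I,
      forall x, I x -> exists z1 z2,
        [/\ tensor_sub I setT z1, tensor_sub setT I z2 &
            comul x = z1 + z2],
      forall x, I x -> counit x = 0 &
      forall x, I x -> I (antipode x)].

Definition inner_linear : Prop :=
  exists I : set H, [/\ two_sided_ideal I, finite_codim I &
    forall J : set H, hopf_ideal J -> J `<=` I -> J `<=` [set 0]].

Definition ad_l (x y : H) : H :=
  tensor_lift (fun a b : H => a * y * antipode b) (comul x).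

Definition ad_r (x y : H) : H :=
  tensor_lift (fun a b : H => antipode a * y * b) (comul x).

End HopfNotions.

Arguments inner_linear {K} H.

Section HopfSubalgebra.
Variables (K : fieldType) (A H : hopfAlgType K).

(* A Hopf subalgebra of H is given as a Hopf algebra A with an injective
   morphism of Hopf algebras to H; the subset is the range of [iota]. *)
Definition hopf_subalgebra (iota : {lrmorphism A -> H}) : Prop :=
  [/\ injective iota,
      forall a, comul (iota a) = tensor_map iota iota (comul a),
      forall a, counit (iota a) = counit a &
      forall a, antipode (iota a) = iota (antipode a)].

Definition ad_stable (iota : A -> H) : Prop :=
  forall (x : H) (a : A),
    range iota (ad_l x (iota a)) /\ range iota (ad_r x (iota a)).

Definition normal_hopf_subalgebra (iota : {lrmorphism A -> H}) : Prop :=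
  hopf_subalgebra iota /\ ad_stable iota.

Definition fin_gen_right_module (iota : A -> H) : Prop :=
  exists (n : nat) (e : 'I_n -> H), forall h : H,
    exists a : 'I_n -> A, h = \sum_(i < n) e i * iota (a i).

End HopfSubalgebra.

(* Main.v *)
Require Import Defs.
From HB Require Import structures.
From mathcomp Require Import all_boot all_order all_algebra.
From mathcomp Require Import complex.
From mathcomp Require Import boolp classical_sets reals.

(** Write q = A+H for the right ideal generated by the augmentation ideal A+ of
    A. Normality makes q a Hopf ideal, and it has finite codimension because H
    is finitely generated over A; so Q = H/q is a finite-dimensional Hopf
    algebra. Let B be the subalgebra of right Q-coinvariants of H. The heart of
    the proof is that B = A and that H is projective over A in a very explicit
    way.

    Projectivity comes from integrals. A trace formula gives left integrals
    t_i in the dual of Q and elements e_i of H with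
    sum_i t_i(x S(e_i)) = eps(x) ([trace_integralP], [trace_integral_counit]).
    The maps T_i(h) = h1 t_i(h2) are left B-linear with values in B, and
    m = sum_i T_i(m S(e_i1)) e_i2, which is a finite dual basis of H over B
    ([coinv_frame_exists]). These maps send every Hopf ideal contained in q
    into itself, so such an ideal is generated by its intersection with B.

    Next, the map x (x) y |-> x S(y1) (x) y2 from H (x) H to H (x)_A H vanishes
    on H (x) q, again by normality. Hence b (x) 1 = 1 (x) b in H (x)_A H for
    every b in B ([coinv_balanced]); tested on balanced maps x c y, this shows
    that B is commutative. Nakayama's lemma for the ideal of the values r(1),
    r : H -> B linear, then gives a B-linear retraction r of H onto B
    ([coinv_retraction]). So B is finitely generated over A, and one removes its
    generators one by one: if the last generator g were not superfluous, the
    annihilator I of g modulo the others would be a proper ideal of A, a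
    functional on H/HI separating 1 from 0 would give a balanced form
    distinguishing g (x) 1 from 1 (x) g, a contradiction ([coinv_sub]).

    Finally let I be an ideal of finite codimension of A without nonzero Hopf
    ideal, and let J be the set of the x in q with Hx inside IH. It is an ideal
    of finite codimension. The retraction gives IH /\ A = I, so a Hopf ideal
    inside J meets A in a Hopf ideal of A contained in I, that is in 0, and is
    therefore zero because it is generated by its intersection with B = A
    ([inner_linear_extension]). *)

Set Implicit Arguments.
Unset Strict Implicit.
Unset Printing Implicit Defensive.

Import GRing.Theory.
Local Open Scope ring_scope.
Local Open Scope classical_set_scope.

(** * Linear maps and Sweedler sums *)

Section Lin.
Variable K : fieldType.
Implicit Types U V W X : lmodType K.

(** Linearity of a bare function: almost all the maps below are lambda terms in
    Sweedler variables, which carry no structure. *)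
Definition lin U V (f : U -> V) : Prop :=
  forall a x y, f (a *: x + y) = a *: f x + f y.

Definition bilin U V W (f : U -> V -> W) : Prop :=
  (forall v, lin (f^~ v)) /\ (forall u, lin (f u)).

Lemma lin0 U V (f : U -> V) : lin f -> f 0 = 0.
Proof. by move=> lf; have := lf (-1) 0 0; rewrite scaler0 addr0 scaleN1r addNr. Qed.

Lemma linD U V (f : U -> V) : lin f -> {morph f : x y / x + y}.
Proof. by move=> lf x y; have := lf 1 x y; rewrite !scale1r. Qed.

Lemma linZ U V (f : U -> V) : lin f -> forall a, {morph f : x / a *: x}.
Proof. by move=> lf a x; have := lf a x 0; rewrite !addr0 (lin0 lf) addr0. Qed.

Lemma linN U V (f : U -> V) : lin f -> {morph f : x / - x}.
Proof. by move=> lf x; rewrite -scaleN1r linZ // scaleN1r. Qed.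

Lemma linB U V (f : U -> V) : lin f -> {morph f : x y / x - y}.
Proof. by move=> lf x y; rewrite linD // linN. Qed.

Lemma lin_sumE U V (f : U -> V) (I : Type) (s : seq I) (F : I -> U) :
  lin f -> f (\sum_(i <- s) F i) = \sum_(i <- s) f (F i).
Proof.
move=> lf; elim: s => [|i s IHs]; first by rewrite !big_nil lin0.
by rewrite !big_cons linD // IHs.
Qed.

Lemma lin_id U : lin (fun x : U => x).
Proof. by []. Qed.

Lemma lin_linear U V (f : {linear U -> V}) : lin f.
Proof. by move=> a x y; rewrite linearP. Qed.

Lemma lin_comp U V W (f : V -> W) (g : U -> V) :
  lin f -> lin g -> lin (fun x => f (g x)).
Proof. by move=> lf lg a x y; rewrite lg lf. Qed.

Lemma lin_mull U (H : algType K) (g : U -> H) (b : H) :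
  lin g -> lin (fun x => g x * b).
Proof. by move=> lg a x y; rewrite lg mulrDl scalerAl. Qed.

Lemma lin_mulr U (H : algType K) (g : U -> H) (b : H) :
  lin g -> lin (fun x => b * g x).
Proof. by move=> lg a x y; rewrite lg mulrDr scalerAr. Qed.

Lemma lin_scaler U V (g : U -> V) (c : K) :
  lin g -> lin (fun x => c *: g x).
Proof. by move=> lg a x y; rewrite lg scalerDr !scalerA mulrC. Qed.

Lemma lin_scalel U V (g : U -> K^o) (v : V) :
  lin g -> lin (fun x => (g x : K) *: v).
Proof. by move=> lg a x y; rewrite lg scalerDl scalerA. Qed.

Lemma lin_add U V (f g : U -> V) : lin f -> lin g -> lin (fun x => f x + g x).
Proof. by move=> lf lg a x y; rewrite lf lg scalerDr addrACA. Qed.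

Lemma lin_opp U V (f : U -> V) : lin f -> lin (fun x => - f x).
Proof. by move=> lf a x y; rewrite lf scalerN opprD. Qed.

Lemma lin_sum U V (I : Type) (s : seq I) (F : I -> U -> V) :
  (forall i, lin (F i)) -> lin (fun x => \sum_(i <- s) F i x).
Proof.
move=> lF a x y; rewrite scaler_sumr -big_split.
by apply: eq_bigr => i _; rewrite lF.
Qed.

Lemma lin_purel U V W (g : W -> U) (v : V) : lin g -> lin (fun x => g x \ox v).
Proof. by move=> lg a x y; rewrite lg pure_tensorDl pure_tensorZl. Qed.

Lemma lin_purer U V W (g : W -> V) (u : U) : lin g -> lin (fun x => u \ox g x).
Proof. by move=> lg a x y; rewrite lg pure_tensorDr pure_tensorZr. Qed.

Lemma bilin_l U V W X (f : U -> V -> W) (g : X -> U) v :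
  bilin f -> lin g -> lin (fun x => f (g x) v).
Proof. by move=> [lf _] lg a x y; rewrite lg lf. Qed.

Lemma bilin_r U V W X (f : U -> V -> W) (g : X -> V) u :
  bilin f -> lin g -> lin (fun x => f u (g x)).
Proof. by move=> [_ lf] lg a x y; rewrite lg lf. Qed.

Lemma liftE U V W (f : U -> V -> W) u v :
  bilin f -> tensor_lift f (u \ox v) = f u v.
Proof. by move=> [fl fr]; apply: tensor_liftE. Qed.

Lemma lin_lift U V W (f : U -> V -> W) : bilin f -> lin (tensor_lift f).
Proof. by move=> [fl fr]; apply: tensor_lift_linear. Qed.

Lemma lin_liftf U V W X (F : X -> U -> V -> W) z :
  (forall u v, lin (fun x => F x u v)) -> lin (fun x => tensor_lift (F x) z).
Proof. by move=> lF; apply: lin_sum => p; apply: lF. Qed.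

Lemma eq_lift U V W (f g : U -> V -> W) z :
  (forall u v, f u v = g u v) -> tensor_lift f z = tensor_lift g z.
Proof. by move=> fg; apply: eq_bigr => p _; apply: fg. Qed.

Lemma lift_lin U V W X (g : W -> X) (f : U -> V -> W) z :
  lin g -> g (tensor_lift f z) = tensor_lift (fun u v => g (f u v)) z.
Proof. by move=> lg; rewrite /tensor_lift lin_sumE. Qed.

(** The Sweedler sum of f(x1, x2). Iterated sums are written by nesting. *)
Definition sw (H : hopfAlgType K) W (f : H -> H -> W) (x : H) : W :=
  tensor_lift f (comul x).

Lemma lin_comul (H : hopfAlgType K) : lin (@comul K H).
Proof. exact: comul_linear. Qed.

Lemma lin_sw U W (H : hopfAlgType K) (f : H -> H -> W) (g : U -> H) :
  bilin f -> lin g -> lin (fun x => sw f (g x)).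
Proof.
move=> bf lg; apply: lin_comp lg; apply: lin_comp (@lin_comul H).
exact: lin_lift.
Qed.

Lemma lin_swf U W (H : hopfAlgType K) (F : U -> H -> H -> W) (y : H) :
  (forall u v, lin (fun x => F x u v)) -> lin (fun x => sw (F x) y).
Proof. exact: lin_liftf. Qed.

Lemma lin_counit (H : hopfAlgType K) : @lin H K^o (counit (s := H)).
Proof. by move=> a x y; rewrite linearP. Qed.

End Lin.

Ltac lin_atom :=
  first [ assumption | solve [auto] | exact: lin_linear | exact: lin_counit
        | exact: lin_comul
        | match goal with bf : bilin ?f |- lin (?f _) => exact: (proj2 bf _) end ].

(** Proves [lin] and [bilin] goals by recursion on the body of the function. A
    metavariable such as [b] can also match a term in the bound variable; the
    [refine] then fails and the matching falls through to a later pattern. *)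
Ltac lin :=
  cbv beta;
  match goal with
  | |- forall _, _ => intro; lin
  | |- bilin _ => solve [auto]
  | |- bilin _ => split; intros; lin
  | |- lin (tensor_lift ?f) => refine (lin_lift _); lin
  | |- lin (sw ?f) => refine (@lin_sw _ _ _ _ f (fun x => x) _ (@lin_id _ _)); lin
  | |- lin (fun x => x) => refine (@lin_id _ _)
  | |- lin (fun x => @GRing.mul _ (@?A x) ?b) => refine (@lin_mull _ _ _ A b _); lin
  | |- lin (fun x => @GRing.mul _ ?b (@?A x)) => refine (@lin_mulr _ _ _ A b _); lin
  | |- lin (fun x => @GRing.scale _ _ ?b (@?A x)) =>
       refine (@lin_scaler _ _ _ A b _); lin
  | |- lin (fun x => @GRing.scale _ _ (@?A x) ?b) =>
       refine (@lin_scalel _ _ _ A b _); lin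
  | |- lin (fun x => @GRing.add _ (@?A x) (@?B x)) =>
       refine (@lin_add _ _ _ A B _ _); lin
  | |- lin (fun x => @GRing.opp _ (@?A x)) => refine (@lin_opp _ _ _ A _); lin
  | |- lin (fun x => \sum_(i <- _) _) => apply: lin_sum; intros; lin
  | |- lin (fun x => pure_tensor (@?A x) ?b) => refine (@lin_purel _ _ _ _ A b _); lin
  | |- lin (fun x => pure_tensor ?b (@?A x)) => refine (@lin_purer _ _ _ _ A b _); lin
  | |- lin (fun x => sw ?f (@?A x)) => refine (@lin_sw _ _ _ _ f A _ _); lin
  | |- lin (fun x => sw (@?F x) ?y) => refine (@lin_swf _ _ _ _ F y _); intros; lin
  | |- lin (fun x => tensor_lift ?f (@?A x)) =>
       refine (@lin_comp _ _ _ _ (tensor_lift f) A (lin_lift _) _); lin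
  | |- lin (fun x => tensor_lift (@?F x) ?y) =>
       refine (@lin_liftf _ _ _ _ _ F y _); intros; lin
  | |- lin (fun x => ?f (@?A x)) =>
       first [ lin_atom
             | refine (@lin_comp _ _ _ _ f A _ _); [lin_atom | lin] ]
  | |- lin (fun x => ?f (@?A x) ?b) =>
       first [ lin_atom
             | refine (@bilin_l _ _ _ _ _ f A b _ _); [lin_atom | lin] ]
  | |- lin (fun x => ?f ?b (@?A x)) =>
       first [ lin_atom
             | refine (@bilin_r _ _ _ _ _ f A b _ _); [lin_atom | lin] ]
  | |- lin _ => try lin_atom
  | |- _ => idtac
  end.

Section Sweedler.
Variables (K : fieldType) (H : hopfAlgType K).
Implicit Types (W : lmodType K) (x y : H).
Notation S := (antipode (s := H)).
Notation eps := (counit (s := H)).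

Lemma eq_sw W (f g : H -> H -> W) x :
  (forall a b, f a b = g a b) -> sw f x = sw g x.
Proof. exact: eq_lift. Qed.

Lemma sw_lin W W' (g : W -> W') (f : H -> H -> W) x :
  lin g -> g (sw f x) = sw (fun a b => g (f a b)) x.
Proof. exact: lift_lin. Qed.

Lemma sw_coassoc W (f : H -> H -> H -> W) x :
  (forall b c, lin (fun a => f a b c)) -> (forall a c, lin (fun b => f a b c)) ->
  (forall a b, lin (f a b)) ->
  sw (fun a b => sw (fun c d => f c d b) a) x =
  sw (fun a b => sw (fun c d => f a c d) b) x.
Proof.
move=> l1 l2 l3.
pose g := tensor_lift (fun u => tensor_lift (fun v w => f u v w)).
have lg : lin g by rewrite /g; lin.
have := congr1 g (comulA x); rewrite /sw.
have -> : g (tensor_assoc (tensor_map comul idfun (comul x))) =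
  tensor_lift (fun a b => tensor_lift (fun c d => f c d b) (comul a)) (comul x).
  rewrite /tensor_map (lift_lin (g := fun z => g (tensor_assoc z))); last first.
    by rewrite /tensor_assoc; lin.
  apply: eq_lift => a b; rewrite /tensor_assoc liftE; last by lin.
  rewrite lift_lin //; apply: eq_lift => c d.
  by rewrite /g !liftE //; lin.
have -> // : g (tensor_map idfun comul (comul x)) =
  tensor_lift (fun a b => tensor_lift (fun c d => f a c d) (comul b)) (comul x).
rewrite /tensor_map (lift_lin (g := g)) //; apply: eq_lift => a b.
by rewrite /g liftE //; lin.
Qed.

End Sweedler.

(** * Identities for the counit and the antipode *)

Section HopfCalculus.
Variables (K : fieldType) (H : hopfAlgType K).
Implicit Types (W : lmodType K) (x y : H).
Notation S := (antipode (s := H)).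
Notation eps := (counit (s := H)).

Lemma sw_counitl W (g : H -> W) x :
  lin g -> sw (fun a b => eps a *: g b) x = g x.
Proof.
move=> lg; rewrite -[in RHS](counitl x) (lift_lin _ _ lg).
by apply: eq_lift => a b; rewrite linZ.
Qed.

Lemma sw_counitr W (g : H -> W) x :
  lin g -> sw (fun a b => eps b *: g a) x = g x.
Proof.
move=> lg; rewrite -[in RHS](counitr x) (lift_lin _ _ lg).
by apply: eq_lift => a b; rewrite linZ.
Qed.

Lemma sw_antipodel W (g : H -> W) x :
  lin g -> sw (fun a b => g (S a * b)) x = eps x *: g 1.
Proof. by move=> lg; rewrite -linZ // -(antipodel x) (lift_lin _ _ lg). Qed.

Lemma sw_antipoder W (g : H -> W) x :
  lin g -> sw (fun a b => g (a * S b)) x = eps x *: g 1.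
Proof. by move=> lg; rewrite -linZ // -(antipoder x) (lift_lin _ _ lg). Qed.

Lemma swM W (f : H -> H -> W) x y : bilin f ->
  sw f (x * y) = sw (fun a b => sw (fun c d => f (a * c) (b * d)) y) x.
Proof.
move=> bf; rewrite /sw rmorphM /= /GRing.mul /= /tensor_mul.
rewrite (lift_lin (g := tensor_lift f)); last by lin.
apply: eq_lift => a b; rewrite (lift_lin (g := tensor_lift f)); last by lin.
by apply: eq_lift => c d; rewrite liftE.
Qed.

Lemma sw1 W (f : H -> H -> W) : bilin f -> sw f 1 = f 1 1.
Proof. by move=> bf; rewrite /sw rmorph1 tensor_one liftE. Qed.

Lemma sw_exchange W (f : H -> H -> H -> H -> W) x y :
  sw (fun a b => sw (fun c d => f a b c d) y) x =
  sw (fun c d => sw (fun a b => f a b c d) x) y.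
Proof. by rewrite /sw /tensor_lift exchange_big. Qed.

Lemma sw_sum W (I : Type) (s : seq I) (F : I -> H -> H -> W) x :
  sw (fun a b => \sum_(i <- s) F i a b) x = \sum_(i <- s) sw (F i) x.
Proof. by rewrite /sw /tensor_lift exchange_big. Qed.

Lemma antipode1 : S 1 = 1.
Proof.
have := antipodel (1 : H); rewrite rmorph1 tensor_one liftE; last by lin.
by rewrite mulr1 rmorph1 scale1r.
Qed.

Lemma counit_antipode x : eps (S x) = eps x.
Proof.
have := @sw_antipodel K^o eps x (@lin_counit K H).
rewrite rmorph1 [RHS]mulr1 => <-.
rewrite -[in LHS](@sw_counitr H (fun a => a) x) //.
rewrite (sw_lin (g := fun z => S z)); last by lin.
rewrite (sw_lin (W' := K^o) (g := fun z => eps z)); last exact: lin_counit.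
rewrite ?rmorph1; apply: (@eq_sw K H K^o) => a b.
by rewrite rmorphM linearZ /= linearZ /= mulrC.
Qed.

Lemma antipodeM x y : S (x * y) = S y * S x.
Proof.
(* Insert x2 y2 S(y3) S(x3) = eps(x2) eps(y2) after S(x1 y1), then collapse
   S(x1 y1) x2 y2 instead. *)
transitivity (sw (fun a b => sw (fun c d =>
    S (a * c) * sw (fun b1 b2 => sw (fun d1 d2 =>
      b1 * d1 * (S d2 * S b2)) d) b) y) x).
  transitivity (sw (fun a b => sw (fun c d => eps d *: (eps b *: S (a * c))) y) x).
    rewrite -[in LHS](@sw_counitr H (fun a => a) x) //.
    rewrite (sw_lin (g := fun a => S (a * y))); last by lin.
    apply: eq_sw => a b; rewrite -scalerAl linearZ /=.
    rewrite -[in LHS](@sw_counitr H (fun a => a) y) //.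
    rewrite (sw_lin (g := fun y => eps b *: S (a * y))); last by lin.
    apply: eq_sw => c d; rewrite -scalerAr linearZ /= !scalerA mulrC.
    by [].
  apply: eq_sw => a b; apply: eq_sw => c d.
  have -> : sw (fun b1 b2 => sw (fun d1 d2 => b1 * d1 * (S d2 * S b2)) d) b =
     (eps b * eps d)%:A.
    transitivity (sw (fun b1 b2 => eps d *: (b1 * S b2)) b).
      apply: eq_sw => b1 b2.
      transitivity (sw (fun d1 d2 => b1 * (d1 * S d2) * S b2) d).
        by apply: eq_sw => d1 d2; rewrite !mulrA.
      by rewrite (sw_antipoder (g := fun z => b1 * z * S b2)) ?mulr1 //; lin.
    by rewrite (sw_antipoder (g := fun z => eps d *: z)) ?scalerA //; lin.
  by rewrite -scalerAr mulr1 scalerA mulrC.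
transitivity (sw (fun a b => sw (fun c d =>
    sw (fun a1 a2 => sw (fun c1 c2 =>
      S (a1 * c1) * (a2 * c2) * (S d * S b)) c) a) y) x).
  transitivity (sw (fun a b => sw (fun b1 b2 => sw (fun c d =>
     sw (fun d1 d2 => S (a * c) * (b1 * d1) * (S d2 * S b2)) d) y) b) x).
    apply: eq_sw => a b; rewrite sw_exchange; apply: eq_sw => c d.
    rewrite (sw_lin (g := fun z => S (a * c) * z)); last by lin.
    apply: eq_sw => b1 b2.
    rewrite (sw_lin (g := fun z => S (a * c) * z)); last by lin.
    by apply: eq_sw => d1 d2; rewrite !mulrA.
  rewrite -(sw_coassoc (f := fun a b1 b2 => sw (fun c d =>
     sw (fun d1 d2 => S (a * c) * (b1 * d1) * (S d2 * S b2)) d) y)); try by lin.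
  apply: eq_sw => a b; rewrite [RHS]sw_exchange; apply: eq_sw => a1 a2.
  by rewrite -(sw_coassoc (f := fun c d1 d2 => S (a1 * c) * (a2 * d1) * (S d2 * S b)))
      //; lin.
transitivity (sw (fun a b => sw (fun c d => (eps a * eps c) *: (S d * S b)) y) x).
  apply: eq_sw => a b; apply: eq_sw => c d.
  rewrite -(swM (f := fun u v => S u * v * (S d * S b))); last by lin.
  rewrite (sw_antipodel (g := fun z => z * (S d * S b))); last by lin.
  by rewrite rmorphM mul1r.
transitivity (sw (fun a b => eps a *: (S y * S b)) x).
  apply: eq_sw => a b; rewrite -(@sw_counitl H (fun d => eps a *: (S d * S b)) y);
      last by lin.
  by apply: eq_sw => c d; rewrite scalerA mulrC.
by rewrite (@sw_counitl H (fun b => S y * S b)) //; lin.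
Qed.

Lemma lin_tmull (z : tensor H H) : lin (fun w : tensor H H => w * z : tensor H H).
Proof. by rewrite /GRing.mul /= /tensor_mul; lin. Qed.

Lemma lin_tmulr (z : tensor H H) : lin (fun w : tensor H H => z * w : tensor H H).
Proof. by rewrite /GRing.mul /= /tensor_mul; lin. Qed.

Lemma comulE x : comul x = sw (fun a b => a \ox b) x.
Proof.
have lf : lin (tensor_lift (fun a b : H => a \ox b)) by lin.
rewrite -[LHS](tensor_lin_ext (g := id) lf) // => u v.
by rewrite liftE //; lin.
Qed.

(** Both sides are convolution inverses of the coproduct, as maps to H (x) H: the
    left one on the left, the right one, called N below, on the right. *)
Lemma comul_antipode x : comul (S x) = sw (fun a b => S b \ox S a) x.
Proof.
pose N (x : H) : tensor H H := sw (fun a b => S b \ox S a) x.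
have lN : lin N by rewrite /N; lin.
have DN y : sw (fun a b => comul a * N b : tensor H H) y = eps y *: (1 \ox 1).
  transitivity (sw (fun a b => sw (fun c d => sw (fun c1 c2 => (a * S d) \ox (c1 * S
      c2)) c) b) y).
    transitivity (sw (fun a b => sw (fun c1 c2 => sw (fun d1 d2 => (c1 * S d2) \ox (c2
        * S d1)) b) a) y).
      apply: eq_sw => a b.
      rewrite comulE.
      rewrite (sw_lin (g := fun z : tensor H H => z * N b : tensor H H));
          last exact: lin_tmull.
      apply: eq_sw => c1 c2; rewrite (sw_lin (g := fun z : tensor H H => _ * z :
          tensor H H)); last exact: lin_tmulr.
      by apply: eq_sw => d1 d2; rewrite tensor_mul_pure.
    rewrite (sw_coassoc (f := fun c1 c2 b => sw (fun d1 d2 => (c1 * S d2) \ox (c2 * S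
        d1)) b)); [|lin..].
    apply: eq_sw => a b.
    by rewrite -(sw_coassoc (f := fun c2 d1 d2 => (a * S d2) \ox (c2 * S d1))) //; lin.
  transitivity (sw (fun a b => (a * S b) \ox (1 : H)) y).
    apply: eq_sw => a b; rewrite -(@sw_counitl _ (fun d => (a * S d) \ox 1) b);
        last by lin.
    by apply: eq_sw => c d; rewrite (sw_antipoder (g := fun z => (a * S d) \ox z)) //;
        lin.
  by rewrite (sw_antipoder (g := fun z => z \ox 1)) //; lin.
rewrite -[in LHS](@sw_counitr H (fun a => a) x) //.
rewrite (sw_lin (g := fun z => comul (S z))); last by lin.
transitivity (sw (fun a b => sw (fun b1 b2 => comul (S a) * (comul b1 * N b2) : tensor
    H H) b) x).
  apply: eq_sw => a b; rewrite -(sw_lin (g := fun z : tensor H H => comul (S a) * z :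
      tensor H H)); last exact: lin_tmulr.
  rewrite DN (linZ (lin_tmulr _)) -tensor_one mulr1.
  by rewrite linearZ /= (linZ (@lin_comul K H)).
rewrite -(sw_coassoc (f := fun a b1 b2 => comul (S a) * (comul b1 * N b2) : tensor H
    H)); last first.
- by move=> a b; apply: lin_comp (lin_tmulr _) _; apply: lin_comp (lin_tmulr _) _.
- move=> a b; apply: (lin_comp (lin_tmulr _) (lin_comp (lin_tmull _) (@lin_comul K H))).
- move=> a b; apply: (lin_comp (lin_tmull _) (lin_comp (@lin_comul K H) _)); lin.
transitivity (sw (fun a b => eps a *: N b) x); last exact: sw_counitl.
apply: eq_sw => a b.
transitivity (sw (fun a1 a2 => comul (S a1 * a2) * N b : tensor H H) a).
  by apply: eq_sw => a1 a2; rewrite rmorphM mulrA.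
rewrite (sw_antipodel (g := fun z => comul z * N b : tensor H H)).
  by rewrite rmorph1 mul1r.
exact: lin_comp (lin_tmull _) (@lin_comul K H).
Qed.

(** This and the next lemma are the only way in which the coalgebra
    antihomomorphism property of the antipode is used. *)
Lemma swS W (f : H -> H -> W) x : bilin f ->
  sw f (S x) = sw (fun a b => f (S b) (S a)) x.
Proof.
move=> bf; rewrite /sw comul_antipode (sw_lin (g := tensor_lift f)); last by lin.
by apply: eq_sw => a b; rewrite liftE.
Qed.

Lemma swSS W (f : H -> H -> W) x : bilin f ->
  sw f (S (S x)) = sw (fun a b => f (S (S a)) (S (S b))) x.
Proof. by move=> bf; rewrite swS // swS //; lin. Qed.

End HopfCalculus.

(** * Subspaces, functionals and finite codimension *)

Section Subspaces.
Variables (K : fieldType) (V : lmodType K).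
Implicit Types S M : set V.

Definition subspace S := S 0 /\ forall a x y, S x -> S y -> S (a *: x + y).

Lemma subspaceD S x y : subspace S -> S x -> S y -> S (x + y).
Proof. by move=> [_ hS] Sx Sy; rewrite -[x]scale1r; exact: hS. Qed.

Lemma subspaceZ S a x : subspace S -> S x -> S (a *: x).
Proof. by move=> [S0 hS] Sx; rewrite -[_ *: _]addr0; exact: hS. Qed.

Lemma subspaceN S x : subspace S -> S x -> S (- x).
Proof. by move=> hS Sx; rewrite -scaleN1r; exact: subspaceZ. Qed.

Lemma subspaceB S x y : subspace S -> S x -> S y -> S (x - y).
Proof. by move=> hS Sx Sy; apply: subspaceD => //; exact: subspaceN. Qed.

Lemma subspace_sum S (I : Type) (s : seq I) (F : I -> V) :
  subspace S -> (forall i, S (F i)) -> S (\sum_(i <- s) F i).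
Proof.
by move=> hS SF; apply: big_ind => //; [exact: hS.1 | move=> x y; exact: subspaceD].
Qed.

Lemma subspace_sum_mem S (I : eqType) (s : seq I) (F : I -> V) :
  subspace S -> (forall i, i \in s -> S (F i)) -> S (\sum_(i <- s) F i).
Proof.
move=> hS SF; rewrite big_seq; apply: big_ind => //; first exact: hS.1.
by move=> x y; exact: subspaceD.
Qed.

(** A subspace maximal among those that contain S and avoid u is a hyperplane. *)
Lemma separation S u : subspace S -> ~ S u ->
  exists l : V -> K^o, [/\ lin l, forall x, S x -> l x = 0 & l u = 1].
Proof.
move=> hS Su.
pose P (X : set V) := subspace (X `|` S) /\ ~ (X `|` S) u.
have [F FP Ftot|X [[hM Mu] Xmax]] := @Zorn_bigcup V P.
  split; last by case=> // -[X FX Xu]; apply: (FP X FX).2; left.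
  split=> [|a x y]; first by right; exact: hS.1.
  have up X z : F X -> (X `|` S) z -> (\bigcup_(X in F) X `|` S) z.
    by move=> FX [Xz|]; [left; exists X | right].
  case=> [[X FX Xx]|Sx] [[Y FY Yy]|Sy].
  - have [XY|YX] := Ftot X Y FX FY.
      by apply: (up Y) => //; apply: (FP Y FY).1.2; left; [exact: XY|].
    by apply: (up X) => //; apply: (FP X FX).1.2; left; [|exact: YX].
  - by apply: (up X) => //; apply: (FP X FX).1.2; [left|right].
  - by apply: (up Y) => //; apply: (FP Y FY).1.2; [right|left].
  by right; apply: hS.2.
set M := X `|` S in hM Mu.
have cofM x : exists c : K, M (x - c *: u).
  have [Mx|Mx] := pselect (M x); first by exists 0; rewrite scale0r subr0.
  pose N y := exists c : K, M (y - c *: x).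
  have hN : subspace N.
    split=> [|a y z [c My] [d Mz]]; first by exists 0; rewrite scale0r subr0;
        exact: hM.1.
    exists (a * c + d); rewrite scalerDl -scalerA opprD addrACA -scalerBr.
    exact: hM.2.
  have MN y : M y -> N y by move=> My; exists 0; rewrite scale0r subr0.
  have NS : N `|` S = N.
    by apply/seteqP; split=> y; [case=> // Sy; apply: MN; right | left].
  have := Xmax N; rewrite /P NS => nPN.
  have [Nu|Nu] := pselect (N u); last first.
    exfalso; apply: nPN; last by split.
    split; first by move=> y Xy; apply: MN; left.
    move=> NX; apply: Mx; left; apply: NX.
    by exists 1; rewrite scale1r subrr; exact: hM.1.
  have [c Mc] := Nu; have [c0|c0] := eqVneq c 0.
    by case: Mu; move: Mc; rewrite c0 scale0r subr0.
  exists c^-1; have := subspaceZ (- c^-1) hM Mc.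
  by rewrite scalerBr !scaleNr opprK scalerA mulVf // scale1r addrC.
have uniqM (c d : K) x : M (x - c *: u) -> M (x - d *: u) -> c = d.
  move=> Mc Md; apply/eqP; rewrite -subr_eq0; apply: contrapT => /negP cd.
  apply: Mu; have := subspaceZ (c - d)^-1 hM (subspaceB hM Md Mc).
  have -> : x - d *: u - (x - c *: u) = (c - d) *: u.
    by rewrite opprB addrC addrA addrNK scalerBl.
  by rewrite scalerA mulVf // scale1r.
pose l x : K^o := projT1 (cid (cofM x)).
have lP x : M (x - (l x : K) *: u) by exact: (projT2 (cid (cofM x))).
exists l; split.
- move=> a x y; apply: (@uniqM _ _ (a *: x + y)); first exact: lP.
  rewrite scalerDl -scalerA opprD addrACA -scalerBr.
  exact: (hM.2 _ _ _ (lP x) (lP y)).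
- by move=> x Sx; apply: (uniqM _ _ x (lP x)); rewrite scale0r subr0; right.
- by apply: (uniqM _ _ u (lP u)); rewrite scale1r subrr; exact: hM.1.
Qed.

Definition fproj n (e : 'I_n -> V) (c : 'I_n -> V -> K^o) x : V :=
  \sum_i (c i x : K) *: e i.

(** The c_i read off coordinates modulo S; the last condition makes the map
    fproj, which has finite rank, idempotent. *)
Definition dual_system S n (e : 'I_n -> V) (c : 'I_n -> V -> K^o) : Prop :=
  [/\ forall i, lin (c i), forall i x, S x -> c i x = 0 &
      forall i x, c i (x - fproj e c x) = 0].

Lemma lin_fproj n (e : 'I_n -> V) (c : 'I_n -> V -> K^o) :
  (forall i, lin (c i)) -> lin (fproj e c).
Proof. by move=> lc; apply: lin_sum => i; apply: lin_scalel. Qed.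

(** Gram-Schmidt without a form: each new vector is first replaced by its
    residue w modulo the vectors already chosen, and a functional that separates
    w from S is corrected so as to vanish on them. The subspace E records where
    the chosen vectors lie; [tensor_kernel] needs it. *)
Lemma dual_system_exists S E (us : seq V) : subspace S -> subspace E ->
  (forall u, u \in us -> E u) ->
  exists n (e : 'I_n -> V) (c : 'I_n -> V -> K^o),
    [/\ dual_system S e c, forall i, E (e i) &
        forall u, u \in us -> S (u - fproj e c u)].
Proof.
move=> hS hE; elim: us => [|u us IHus] usE.
  by exists 0, (fun=> 0), (fun=> fun=> 0); split=> //; [split; case | case].
have [|n [e [c [[lc Sc pc] eE ecP]]]] := IHus.
  by move=> v vus; apply: usE; rewrite inE vus orbT.
have lp := lin_fproj e lc.
set w := u - fproj e c u.
have [Sw|Sw] := pselect (S w).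
  by exists n, e, c; split=> // v; rewrite inE => /predU1P[->//|]; exact: ecP.
have [l [ll lS lw]] := separation hS Sw.
have p0 x : fproj e c (x - fproj e c x) = 0.
  by rewrite /fproj big1 // => i _; rewrite pc scale0r.
pose m x : K^o := l (x - fproj e c x).
have lm : lin m by move=> a x y; rewrite /m lp opprD addrACA -scalerBr ll.
have mw : m w = 1 by rewrite /m /w p0 subr0 lw.
have m0 x : m (fproj e c x) = 0.
  have e0 : fproj e c (fproj e c x) = fproj e c x.
    by apply/esym/eqP; rewrite -subr_eq0 -(linB lp) p0.
  by rewrite /m e0 subrr lin0.
pose e' i := oapp e w (unlift ord0 i).
pose c' i := oapp c m (unlift ord0 i).
have projE x : fproj e' c' x = (m x : K) *: w + fproj e c x.
  rewrite /fproj big_ord_recl /e' /c' unlift_none /=; congr (_ + _).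
  by apply: eq_bigr => i _; rewrite liftK.
have cw i : c i w = 0 by exact: pc.
exists n.+1, e', c'; split; last first.
- move=> v; rewrite inE projE opprD addrA addrAC => /predU1P[->|vus].
    have -> : m u = 1 by rewrite /m lw.
    by rewrite scale1r subrr; exact: hS.1.
  have Sv := ecP v vus; rewrite /m (lS _ Sv) scale0r subr0; exact: Sv.
- move=> i; rewrite /e'; case: (unliftP ord0 i) => [j _|_] //=.
  apply: subspaceB => //; first by apply: usE; rewrite mem_head.
  by apply: subspace_sum => // j; exact: subspaceZ.
  split=> [i|i x Sx|i x]; rewrite /c'; case: (unliftP ord0 i) => [j _|_] /=.
  - exact: lc.
  - exact: lm.
  - exact: Sc.
  - have p0x : fproj e c x = 0 by rewrite /fproj big1 // => j _; rewrite Sc // scale0r.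
    by rewrite /m p0x subr0 lS.
  - by rewrite projE [X in _ - X]addrC opprD addrA (linB (lc j)) pc (linZ (lc j)) cw
      scaler0 subr0.
  by rewrite projE opprD addrA addrAC (linB lm) (linB lm x) m0 subr0 (linZ lm) mw [_
      *: 1]mulr1 subrr.
Qed.

End Subspaces.

Section FiniteCodimension.
Variables (K : fieldType) (H : hopfAlgType K).
Implicit Types S : set H.

Lemma finite_codim_dual S : subspace S -> finite_codim S ->
  exists n (e : 'I_n -> H) (c : 'I_n -> H -> K^o),
    dual_system S e c /\ forall h, S (h - fproj e c h).
Proof.
move=> hS [m [g gP]].
have [//||n [e [c [[lc Sc pc] _ ecP]]]] :=
  @dual_system_exists _ _ S setT [seq g i | i <- enum 'I_m] hS; first by [].
exists n, e, c; split=> // h; have [a Sa] := gP h.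
have lp := lin_fproj e lc.
have -> : h = (h - \sum_i a i *: g i) + \sum_i a i *: g i by rewrite addrNK.
rewrite (linD lp); move: (h - _) Sa => x Sx.
have -> : fproj e c x = 0 by rewrite /fproj big1 // => j _; rewrite Sc // scale0r.
rewrite add0r (lin_sumE _ _ lp) -addrA -sumrB; apply: subspaceD => //.
apply: subspace_sum => // i; rewrite (linZ lp) -scalerBr; apply: subspaceZ => //.
by apply: ecP; apply: map_f; rewrite mem_enum.
Qed.

(** Each further functional costs at most one more vector, one on which it is
    nonzero while the preceding functionals vanish. *)
Lemma finite_codim_kernels (I : finType) (d : I -> H -> K^o) :
  (forall i, lin (d i)) -> finite_codim [set x | forall i, d i x = 0].
Proof.
move=> ld.
have [n [e eP]] : finite_codim [set x | forall i, i \in enum I -> d i x = 0].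
  elim: (enum I) => [|i s [n [e eP]]].
    by exists 0, (fun=> 0) => h; exists (fun=> 0).
  have [dS|] := pselect (forall x, (forall j, j \in s -> d j x = 0) -> d i x = 0).
    exists n, e => h; have [a aP] := eP h; exists a => j.
    by rewrite inE => /predU1P[->|/aP//]; exact: dS.
  move=> /existsNP[x /not_implyP[xs xi]].
  exists n.+1, (fun k => oapp e x (unlift ord0 k)) => h; have [a aP] := eP h.
  set y := h - _ in aP.
  exists (fun k => oapp a ((d i y : K) / (d i x : K)) (unlift ord0 k)) => j.
  rewrite big_ord_recl unlift_none /=.
  under eq_bigr => k _ do rewrite liftK /=.
  rewrite opprD addrA addrAC -/y inE linB // linZ // => /predU1P[->|js].
    by rewrite -[_ *: _]/(_ * _) divfK ?subrr //; apply/eqP.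
  by rewrite aP // (xs j) // scaler0 subrr.
exists n, e => h; have [a aP] := eP h; exists a => i.
by apply: aP; rewrite mem_enum.
Qed.

End FiniteCodimension.

Section TensorKernel.
Variables (K : fieldType) (A H : hopfAlgType K).

(** The kernel of f (x) f modulo S is the expected one: after rewriting the left
    factors of z, modulo the preimage of S, in terms of vectors g_i taken from a
    dual system, the coordinate functionals applied to the left factors show that
    the corresponding right factors lie in the preimage of S. *)
Lemma tensor_kernel (f : A -> H) (S : set H) (z : tensor A A) (z1 z2 : tensor H H) :
  lin f -> subspace S -> tensor_sub S setT z1 -> tensor_sub setT S z2 ->
  tensor_map f f z = z1 + z2 ->
  exists y1 y2, [/\ tensor_sub (f @^-1` S) setT y1,
    tensor_sub setT (f @^-1` S) y2 & z = y1 + y2].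
Proof.
move=> lf hS [s1 s1S ->] [s2 s2S ->]; have [s ->] := tensor_spanP z => fz.
have hE : subspace (range f).
  split; first by exists 0; rewrite ?lin0.
  by move=> a _ _ [x _ <-] [y _ <-]; exists (a *: x + y); rewrite ?lf.
have [//|u /mapP[p _ ->]|n [e [c [[lc Sc _] eE ecP]]]] :=
  @dual_system_exists _ _ S (range f) [seq f p.1 | p <- s] hS.
  by exists p.1.
have [g gE] : exists g : 'I_n -> A, forall i, f (g i) = e i.
  by exists (fun i => sval (cid2 (eE i))) => i; case: (cid2 (eE i)).
pose r (u : A) := u - \sum_i (c i (f u) : K) *: g i.
have rS u : u \in [seq p.1 | p <- s] -> S (f (r u)).
  move=> us; rewrite /r linB // lin_sumE //.
  under eq_bigr => i _ do rewrite linZ // gE.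
  by apply: ecP; rewrite (map_comp f); apply: map_f.
exists (\sum_(p <- [seq (r p.1, p.2) | p <- s]) p.1 \ox p.2).
exists (\sum_(p <- [seq (g i, \sum_(q <- s) (c i (f q.1) : K) *: q.2) | i <- enum 'I_n])
   p.1 \ox p.2).
split.
- exists [seq (r p.1, p.2) | p <- s] => // _ /mapP[p ps ->] /=; split=> //.
  by apply: rS; exact: map_f.
- exists [seq (g i, \sum_(q <- s) (c i (f q.1) : K) *: q.2) | i <- enum 'I_n] => //.
  move=> _ /mapP[i _ ->] /=; split=> //; rewrite /preimage /= lin_sumE //.
  have bl : bilin (fun x y : H => (c i x : K) *: y).
    by split=> [v|u]; [apply: lin_scalel | apply: lin_scaler].
  have := congr1 (tensor_lift (fun x y : H => (c i x : K) *: y)) fz.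
  have bf : bilin (fun u v => f u \ox f v) by lin.
  rewrite (linD (lin_lift bl)) /tensor_map (lin_sumE _ _ (lin_lift bf)).
  rewrite !(lin_sumE _ _ (lin_lift bl)).
  under eq_bigr => p _ do rewrite (liftE _ _ bf) (liftE _ _ bl) -linZ //.
  move=> ->; apply: subspaceD => //; apply: subspace_sum_mem => // p ps.
    by rewrite liftE // Sc ?scale0r; [exact: hS.1 | case: (s1S p ps)].
  by rewrite liftE //; apply: subspaceZ => //; case: (s2S p ps).
rewrite !big_map.
transitivity (\sum_(p <- s) (r p.1 \ox p.2 + \sum_i g i \ox ((c i (f p.1) : K) *:
    p.2))).
  apply: eq_bigr => p _; rewrite [in LHS](_ : p.1 = r p.1 + \sum_i (c i (f p.1) : K)
      *: g i); last by rewrite addrNK.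
  rewrite pure_tensorDl; congr (_ + _).
  rewrite (lin_sumE _ _ (f := fun u => u \ox p.2)); last by lin.
  by apply: eq_bigr => i _; rewrite pure_tensorZl pure_tensorZr.
rewrite big_split exchange_big /=; congr (_ + _); rewrite ?big_enum /=;
    apply: eq_bigr => i _.
by rewrite (lin_sumE _ _ (f := fun u => g i \ox u)) //; lin.
Qed.

End TensorKernel.

(** * Integrals on a finite-dimensional quotient *)

Section HopfIdeals.
Variables (K : fieldType) (H : hopfAlgType K).
Implicit Types (W : lmodType K) (x y : H) (q : set H).
Notation S := (antipode (s := H)).
Notation eps := (counit (s := H)).

Lemma ideal_subspace q : two_sided_ideal q -> subspace q.
Proof.
move=> [q0 qD qM]; split=> // a x y qx qy; apply: qD => //.
by rewrite -[x]mul1r scalerAl; exact: (qM _ _ qx).1.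
Qed.

(** How the inclusion of the coproduct of q in q (x) H + H (x) q is used. *)
Lemma hopf_ideal_sw q W (M : set W) (F : H -> H -> W) x :
  hopf_ideal q -> subspace M -> bilin F ->
  (forall a b, q a -> M (F a b)) -> (forall a b, q b -> M (F a b)) ->
  q x -> M (sw F x).
Proof.
move=> [_ qD _ _] hM bF Fl Fr /qD[z1 [z2 [[s1 s1q ->] [s2 s2q ->] xE]]].
rewrite /sw xE (linD (lin_lift bF)) !(lin_sumE _ _ (lin_lift bF)).
apply: subspaceD => //; apply: subspace_sum_mem => // p ps; rewrite liftE //.
  by apply: Fl; case: (s1q p ps).
by apply: Fr; case: (s2q p ps).
Qed.

(** The dual space of H/q, as a set of functionals on H. *)
Definition annih q (f : H -> K^o) := lin f /\ forall x, q x -> f x = 0.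

Lemma subspace0 W : subspace [set (0 : W)].
Proof. by split=> // a _ _ -> ->; rewrite scaler0 addr0. Qed.

Lemma hopf_ideal_sw0 q W (F : H -> H -> W) x :
  hopf_ideal q -> bilin F ->
  (forall a b, q a -> F a b = 0) -> (forall a b, q b -> F a b = 0) ->
  q x -> sw F x = 0.
Proof. by move=> hq bF Fl Fr; apply: (hopf_ideal_sw hq (@subspace0 W)). Qed.

(** The hit action h1 f(h2) of the dual algebra on H. *)
Definition hit (f : H -> K^o) (h : H) : H := sw (fun a b => (f b : K) *: a) h.

(** The right coinvariants of H under H/q, tested on functionals. *)
Definition coinv q : set H := [set b | forall f, annih q f -> hit f b = (f 1 : K) *: b].

End HopfIdeals.

Section Integrals.
Variables (K : fieldType) (H : hopfAlgType K) (q : set H).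
Variables (n : nat) (e : 'I_n -> H) (c : 'I_n -> H -> K^o).
Hypothesis hq : hopf_ideal q.
Hypothesis dual_c : dual_system q e c.
Hypothesis cofin_q : forall h, q (h - fproj e c h).
Implicit Types (W : lmodType K) (x y : H).
Notation S := (antipode (s := H)).
Notation eps := (counit (s := H)).

Let iq : two_sided_ideal q. Proof. by case: hq. Qed.
Let lc i : lin (c i). Proof. by case: dual_c. Qed.
Let c0 i x : q x -> c i x = 0. Proof. by case: dual_c => _ + _; exact. Qed.
Let qS x : q x -> q (S x). Proof. by case: hq => _ _ _; exact. Qed.
Let qMl x y : q y -> q (x * y). Proof. by move=> qy; case: iq => _ _ /(_ x y qy)[]. Qed.
Let qMr x y : q x -> q (x * y). Proof. by move=> qx; case: iq => _ _ /(_ y x qx)[]. Qed.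

(** Summing over e_i against c_i(y) substitutes y for e_i; this is what makes the
    traces below cyclic. *)
Lemma dual_expand W (G : H -> W) y : lin G -> (forall x, q x -> G x = 0) ->
  \sum_i (c i y : K) *: G (e i) = G y.
Proof.
move=> lG G0; have := G0 _ (cofin_q y); rewrite linB // /fproj lin_sumE //.
by move=> /subr0_eq ->; apply: eq_bigr => i _; rewrite linZ.
Qed.

(** The trace of the endomorphism y |-> x S^2(y1) g(y2) of H/q. It is the
    projection of g to the integrals in the Hopf module structure that Larson
    and Sweedler put on the dual of H/q. *)
Definition trace_integral (g : H -> K^o) (x : H) : K^o :=
  \sum_k sw (fun u v => (c k (x * S (S u)) : K) *: g v) (e k).

Lemma trace_integral_annih g : annih q g -> annih q (trace_integral g).
Proof.
move=> [lg g0]; split; first by rewrite /trace_integral; lin.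
move=> x qx; rewrite /trace_integral big1 // => k _.
rewrite /sw /tensor_lift big1 // => p _.
by rewrite c0 ?scale0r //; exact: qMr.
Qed.

(** Left invariance. Write x1 (x) x2 S^2(u) as the coproduct of x S^2(u2) times
    S(u1) (x) 1; then cyclicity of the trace moves S(u1) next to the first factor
    of the coproduct of e_l, where it cancels. *)
Lemma trace_integralP f g x : annih q f -> annih q g ->
  sw (fun a b => (f a : K) *: trace_integral g b) x =
  (f 1 : K) *: trace_integral g x.
Proof.
move=> [lf f0] [lg g0].
(* The identity S^2(p) S(u1) = S(u1 S(p)) lets the antipode axiom apply. *)
have shift u k : sw (fun a b => (f a : K) *: c k (b * S (S u))) x =
    sw (fun u1 u2 => sw (fun a b => (f (a * S u1) : K) *: c k b) (x * S (S u2))) u.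
  transitivity (sw (fun a b => sw (fun u1 u2 => sw (fun p r =>
      (f (a * S (u1 * S p)) : K) *: c k (b * S (S r))) u2) u) x); last first.
    rewrite [RHS](eq_sw (g := fun u1 u2 => sw (fun a b => sw (fun p r =>
      (f (a * S (u1 * S p)) : K) *: c k (b * S (S r))) u2) x)).
      by rewrite /sw /tensor_lift exchange_big.
    move=> u1 u2; rewrite swM; last by lin.
    apply: eq_sw => a b; rewrite swSS; last by lin.
    by apply: eq_sw => p r; rewrite antipodeM !mulrA.
  apply: eq_sw => a b.
  rewrite -(sw_coassoc (f := fun u1 p r => (f (a * S (u1 * S p)) : K) *: c k (b * S (S
      r)))); try by lin.
  rewrite -(@sw_counitl _ _ _ (fun u => (f a : K) *: c k (b * S (S u)))); last by lin.
  apply: eq_sw => w r; rewrite (sw_antipoder (g := fun z => (f (a * S z) : K) *: c k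
      (b * S (S r)))); last by lin.
  by rewrite antipode1 mulr1.
transitivity (\sum_k sw (fun u v => sw (fun u1 u2 => \sum_l (c l (x * S (S u2)) : K) *:
    sw (fun a b => (f (a * S u1) : K) *: ((c k b : K) *: g v)) (e l)) u) (e k)).
  rewrite [LHS](eq_sw (g := fun a b => \sum_k sw (fun u v =>
      (f a : K) *: ((c k (b * S (S u)) : K) *: g v)) (e k))); last first.
    move=> a b; rewrite /trace_integral scaler_sumr; apply: eq_bigr => k _.
    by rewrite (sw_lin (g := fun z => (f a : K) *: z)) //; lin.
  rewrite sw_sum; apply: eq_bigr => k _; rewrite sw_exchange; apply: eq_sw => u v.
  transitivity ((sw (fun a b => (f a : K) *: c k (b * S (S u))) x : K) *: g v).
    rewrite (sw_lin (W := K^o) (g := fun z : K^o => (z : K) *: g v)); last by lin.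
    by apply: eq_sw => a b; rewrite scalerA.
  rewrite shift (sw_lin (W := K^o) (g := fun z : K^o => (z : K) *: g v)); last by lin.
  apply: eq_sw => u1 u2; rewrite (dual_expand (G := fun z =>
    sw (fun a b => (f (a * S u1) : K) *: ((c k b : K) *: g v)) z)).
  - rewrite (sw_lin (W := K^o) (g := fun z : K^o => (z : K) *: g v)); last by lin.
    by apply: eq_sw => a b; rewrite -scalerA.
  - by lin.
  - move=> z qz; apply: (hopf_ideal_sw0 hq) qz; first by lin.
      by move=> a b qa; rewrite f0 ?scale0r //; exact: qMr.
    by move=> a b qb; rewrite c0 ?scale0r ?scaler0.
(* Phi l a collects everything that depends on e_k, so that summing over k
   substitutes b for e_k. *)
pose Phi l a y := sw (fun u v => sw (fun u1 u2 =>
   (c l (x * S (S u2)) : K) *: ((f (a * S u1) : K) *: g v)) u) y.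
have lPhi l a : lin (Phi l a) by rewrite /Phi; lin.
have Phi0 l a y : q y -> Phi l a y = 0.
  apply: (hopf_ideal_sw0 hq); first by lin.
    move=> u v qu; apply: (hopf_ideal_sw0 hq) qu; first by lin.
      by move=> u1 u2 qu1; rewrite f0 ?scale0r ?scaler0 //; do 2?apply: qMl; exact: qS.
    by move=> u1 u2 qu2; rewrite c0 ?scale0r //; apply: qMl; do 2!apply: qS.
  by move=> u v qv; rewrite /sw /tensor_lift big1 // => p _; rewrite g0 // !scaler0.
transitivity (\sum_l sw (fun a b => Phi l a b) (e l)).
  transitivity (\sum_l sw (fun a b => \sum_k (c k b : K) *: Phi l a (e k)) (e l));
      last first.
    by apply: eq_bigr => l _; apply: eq_sw => a b;
        rewrite (dual_expand _ (lPhi l a) (Phi0 l a)).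
  under [RHS]eq_bigr => l _ do rewrite sw_sum.
  rewrite exchange_big; apply: eq_bigr => k _ /=.
  rewrite [LHS](eq_sw (g := fun u v => \sum_l sw (fun u1 u2 => (c l (x * S (S u2)) :
      K) *:
    sw (fun a b => (f (a * S u1) : K) *: ((c k b : K) *: g v)) (e l)) u)); last first.
    by move=> u v; rewrite sw_sum.
  rewrite sw_sum; apply: eq_bigr => l _.
  rewrite [RHS](eq_sw (g := fun a b => sw (fun u v => sw (fun u1 u2 =>
     (c l (x * S (S u2)) : K) *: ((f (a * S u1) : K) *: ((c k b : K) *: g v))) u) (e
         k))); last first.
    move=> a b; rewrite /Phi (sw_lin (g := fun z => (c k b : K) *: z)); last by lin.
    apply: eq_sw => u v; rewrite (sw_lin (g := fun z => (c k b : K) *: z)); last by lin.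
    apply: eq_sw => u1 u2; rewrite !scalerA; congr (_ *: _).
    by rewrite mulrC -mulrA.
  rewrite [RHS]sw_exchange; apply: eq_sw => u v.
  rewrite [RHS]sw_exchange; apply: eq_sw => u1 u2.
  by rewrite (sw_lin (g := fun z => (c l (x * S (S u2)) : K) *: z)) //; lin.
rewrite /trace_integral scaler_sumr; apply: eq_bigr => l _.
rewrite /Phi.
transitivity (sw (fun a b => sw (fun u1 w => sw (fun u2 v =>
   (c l (x * S (S u2)) : K) *: ((f (a * S u1) : K) *: g v)) w) b) (e l)).
  apply: eq_sw => a b.
  by rewrite (sw_coassoc (f := fun u1 u2 v => (c l (x * S (S u2)) : K) *: ((f (a * S
      u1) : K) *: g v))) //; lin.
rewrite -(sw_coassoc (f := fun a u1 w => sw (fun u2 v =>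
   (c l (x * S (S u2)) : K) *: ((f (a * S u1) : K) *: g v)) w)); try by lin.
rewrite -(@sw_counitl _ _ _ (fun w => (f 1 : K) *: sw (fun u v => (c l (x * S (S u)) :
    K) *: g v) w)); last by lin.
apply: eq_sw => p w.
rewrite (sw_antipoder (g := fun z => sw (fun u2 v => (c l (x * S (S u2)) : K) *: ((f z
    : K) *: g v)) w)); last by lin.
rewrite (sw_lin (g := fun z => (f 1 : K) *: z)); last by lin.
congr (_ *: _); apply: eq_sw => u2 v.
by rewrite !scalerA mulrC.
Qed.

(** The functional eps is recovered from integrals: this is the surjectivity
    half of the Larson-Sweedler theorem, and it replaces the nondegeneracy of a
    single integral. *)
Lemma trace_integral_counit x :
  \sum_i trace_integral (c i) (x * S (e i)) = eps x.
Proof.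
have eps0 y : q y -> eps y = 0 by case: hq => _ _ + _; exact.
transitivity (\sum_k sw (fun u v => c k (x * S v * S (S u))) (e k)).
  rewrite /trace_integral exchange_big; apply: eq_bigr => k _ /=.
  rewrite -sw_sum; apply: eq_sw => u v.
  under eq_bigr => i _ do rewrite [_ *: _]mulrC.
  apply: (@dual_expand K^o (fun y => c k (x * S y * S (S u)))); first by lin.
  by move=> y qy; rewrite c0 //; apply: qMr; apply: qMl; exact: qS.
transitivity (\sum_k (c k x : K) *: (eps (e k) : K^o)).
  apply: eq_bigr => k _.
  rewrite (eq_sw (g := fun u v => c k (x * S (S u * v)))); last first.
    by move=> u v; rewrite antipodeM mulrA.
  rewrite (sw_antipodel (g := fun z => c k (x * S z))); last by lin.
  by rewrite antipode1 mulr1 [_ *: _]mulrC.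
by apply: (@dual_expand K^o (fun y => eps y : K^o)) => //; lin.
Qed.

End Integrals.

(** * A dual basis over the coinvariants *)

Section Coinvariants.
Variables (K : fieldType) (H : hopfAlgType K) (q : set H).
Implicit Types (W : lmodType K) (x y b h : H).
Notation S := (antipode (s := H)).
Notation eps := (counit (s := H)).

Lemma lin_hit (f : H -> K^o) : lin f -> lin (hit f).
Proof. by move=> lf; rewrite /hit; lin. Qed.

Lemma hit_hit (f g : H -> K^o) h : lin f -> lin g ->
  hit f (hit g h) = hit (sw (fun a b => (f a : K) *: g b)) h.
Proof.
move=> lf lg; rewrite {2}/hit (sw_lin (g := hit f)); last exact: lin_hit.
transitivity (sw (fun a b => sw (fun c d => (g b : K) *: ((f d : K) *: c)) a) h).
  apply: eq_sw => a b; rewrite (linZ (lin_hit lf)).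
  by rewrite /hit (sw_lin (g := fun z => (g b : K) *: z)) //; lin.
rewrite (sw_coassoc (f := fun c d b => (g b : K) *: ((f d : K) *: c))); [|lin..].
apply: eq_sw => a b.
rewrite (sw_lin (W := K^o) (g := fun z : K^o => (z : K) *: a)); last by lin.
by apply: eq_sw => c d; rewrite scalerA mulrC.
Qed.

Lemma annihMr f x : two_sided_ideal q -> annih q f -> annih q (fun y => f (y * x)).
Proof.
move=> [_ _ qM] [lf f0]; split=> [|y qy]; first by lin.
by rewrite f0 //; exact: (qM x y qy).2.
Qed.

Lemma coinv_subspace : subspace (coinv q).
Proof.
split=> [f [lf _]|a x y hx hy f hf]; first by rewrite (lin0 (lin_hit lf)) scaler0.
rewrite (lin_hit hf.1) hx // hy //.
by rewrite scalerDr !scalerA mulrC.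
Qed.

Lemma hit_coinvMl f b h : two_sided_ideal q -> annih q f -> coinv q b ->
  hit f (b * h) = b * hit f h.
Proof.
move=> iq hf hb; have [lf f0] := hf; rewrite {1}/hit swM; last by lin.
rewrite /hit (sw_lin (g := fun z => b * z)); last by lin.
transitivity (sw (fun c d => hit (fun y => f (y * d)) b * c) h).
  rewrite /sw /tensor_lift exchange_big; apply: eq_bigr => p _ /=.
  rewrite /hit /sw /tensor_lift mulr_suml; apply: eq_bigr => r _.
  by rewrite scalerAl.
apply: eq_sw => c d; rewrite hb; last exact: annihMr.
by rewrite mul1r -scalerAl -scalerAr.
Qed.

Lemma coinvM b b' : two_sided_ideal q -> coinv q b -> coinv q b' -> coinv q (b * b').
Proof.
by move=> iq hb hb' f hf; rewrite hit_coinvMl // hb' // scalerAr.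
Qed.

(** A finite dual basis (phi, z) of H as a left module over the coinvariants. The
    last clause is what transports Hopf ideals to the coinvariants. *)
Definition coinv_frame N (phi : 'I_N -> H -> H) (z : 'I_N -> H) : Prop :=
  [/\ forall k, lin (phi k),
      forall k h, coinv q (phi k h),
      forall k b h, coinv q b -> phi k (b * h) = b * phi k h,
      forall h, h = \sum_k phi k h * z k &
      forall J, hopf_ideal J -> J `<=` q -> forall k h, J h -> J (phi k h)].

(** From m = sum_i m1 t_i(m2 S(e_i)), insert S(e_i2) e_i3 after m1: the summand
    becomes (m S(e_i1))_1 t_i((m S(e_i1))_2) e_i2. The values are coinvariant
    because t_i is a left integral. *)
Lemma coinv_frame_exists : hopf_ideal q -> finite_codim q ->
  exists N (phi : 'I_N -> H -> H) (z : 'I_N -> H), coinv_frame phi z.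
Proof.
move=> hq fq; have [iq _ _ _] := hq.
have [n [e [c [dc ec]]]] := finite_codim_dual (ideal_subspace iq) fq.
have hc i : annih q (c i) by case: dc => lc c0 _; split=> // x; exact: c0.
pose t i := trace_integral e c (c i).
have ht i : annih q (t i) by exact: (trace_integral_annih hq dc (hc i)).
have lt i : lin (t i) by case: (ht i).
(* The frame is indexed by the terms of the coproducts of all the e_i. *)
pose s := flatten [seq [seq (i, p) | p <- repr (comul (e i))] | i <- enum 'I_n].
pose u k := tnth (in_tuple s) k.
exists (size s), (fun k h => hit (t (u k).1) (h * S (u k).2.1)), (fun k => (u k).2.2).
split.
- by move=> k; apply: lin_comp (lin_hit (lt _)) _; lin.
- move=> k h f hf; rewrite hit_hit //; last by case: hf.
  rewrite [RHS](_ : _ = hit (fun y => (f 1 : K) *: t (u k).1 y) (h * S (u k).2.1)).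
    by apply: eq_sw => a b; rewrite (trace_integralP hq dc ec _ hf).
  rewrite /hit (sw_lin (g := fun z => (f 1 : K) *: z)); last by lin.
  by apply: eq_sw => a b; rewrite scalerA.
- by move=> k b h hb; rewrite -mulrA hit_coinvMl.
- move=> h.
  rewrite -(big_tnth _ _ s xpredT (fun w => hit (t w.1) (h * S w.2.1) * w.2.2)).
  rewrite big_flatten big_map /= big_enum /=.
  under eq_bigr => i _ do rewrite big_map /=.
  transitivity (\sum_i sw (fun x y => (t i (y * S (e i)) : K) *: x) h).
    rewrite -sw_sum -[LHS](@sw_counitr _ _ _ (fun x => x)) //.
    apply: eq_sw => x y; rewrite -scaler_suml.
    by rewrite -(trace_integral_counit hq dc ec).
  apply: eq_bigr => i _.
  rewrite -[RHS]/(sw (fun x y => hit (t i) (h * S x) * y) (e i)).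
  transitivity (sw (fun a b => sw (fun a1 a2 => sw (fun x y =>
      (t i (y * S a1) : K) *: (x * S a2 * b)) h) a) (e i)); last first.
    apply: eq_sw => a b; rewrite /hit swM; last by lin.
    rewrite (sw_lin (g := fun z => z * b)); last by lin.
    rewrite sw_exchange; apply: eq_sw => x y.
    rewrite swS; last by lin.
    rewrite (sw_lin (g := fun z => z * b)); last by lin.
    by apply: eq_sw => a1 a2; rewrite scalerAl.
  rewrite (sw_coassoc (f := fun a1 a2 b => sw (fun x y =>
      (t i (y * S a1) : K) *: (x * S a2 * b)) h)); [|lin..].
  transitivity (sw (fun a b => eps b *: sw (fun x y => (t i (y * S a) : K) *: x) h) (e
      i)).
    by rewrite sw_counitr //; lin.
  apply: eq_sw => a b; rewrite sw_exchange.
  rewrite (sw_lin (g := fun z => eps b *: z)); last by lin.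
  apply: eq_sw => x y.
  rewrite (eq_sw (g := fun c d => (t i (y * S a) : K) *: (x * (S c * d)))); last first.
    by move=> c' d'; rewrite mulrA.
  by rewrite (sw_antipodel (g := fun z => (t i (y * S a) : K) *: (x * z))) ?mulr1 //;
      lin.
- move=> J hJ Jq k h Jh; have [iJ _ _ _] := hJ.
  have sJ := ideal_subspace iJ.
  apply: (hopf_ideal_sw hJ sJ); first by lin.
  + by move=> a b Ja; exact: subspaceZ.
  + move=> a b Jb; have [_ ->] := ht (u k).1; last exact: Jq.
    by rewrite scale0r; exact: sJ.1.
  by case: iJ => _ _ /(_ (S (u k).2.1) h Jh)[].
Qed.

End Coinvariants.

(** * Nakayama's lemma *)

Section Nakayama.
Variable R : pzRingType.
Implicit Types (B T : set R) (zs : seq R) (x y z u : R).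

(** Linear combinations are defined by recursion so that removing a generator is
    a case analysis. *)
Fixpoint comb T zs x : Prop :=
  if zs is z :: zs' then exists2 t, T t & comb T zs' (x - t * z) else x = 0.

Definition add_closed T := T 0 /\ forall x y, T x -> T y -> T (x - y).

Lemma add_closedN T x : add_closed T -> T x -> T (- x).
Proof. by move=> [T0 TB] Tx; rewrite -[- x]add0r; exact: TB. Qed.

Lemma add_closedD T x y : add_closed T -> T x -> T y -> T (x + y).
Proof. by move=> hT Tx Ty; rewrite -[y]opprK; apply: hT.2 => //;
    exact: add_closedN. Qed.

Lemma comb0 T zs : add_closed T -> comb T zs 0.
Proof.
move=> hT; elim: zs => //= z zs IHzs; exists 0; first exact: hT.1.
by rewrite mul0r subr0.
Qed.

Lemma combD T zs x y : add_closed T -> comb T zs x -> comb T zs y -> comb T zs (x + y).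
Proof.
move=> hT; elim: zs x y => [x y -> ->|z zs IHzs x y [s Ts xs] [t Tt yt]] /=.
  by rewrite addr0.
exists (s + t); first exact: add_closedD.
by rewrite mulrDl opprD addrACA; exact: IHzs.
Qed.

Lemma comb_sum T zs (I : Type) (r : seq I) (F : I -> R) : add_closed T ->
  (forall i, comb T zs (F i)) -> comb T zs (\sum_(i <- r) F i).
Proof.
by move=> hT hF; apply: big_ind => //; [exact: comb0 | move=> x y; exact: combD].
Qed.

Lemma comb_sum_mem T zs (I : eqType) (r : seq I) (F : I -> R) : add_closed T ->
  (forall i, i \in r -> comb T zs (F i)) -> comb T zs (\sum_(i <- r) F i).
Proof.
move=> hT hF; rewrite big_seq; apply: big_ind => //; first exact: comb0.
by move=> x y; exact: combD.
Qed.

Lemma comb_scale T B zs m x : (forall t, B t -> T (m * t)) ->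
  comb B zs x -> comb T zs (m * x).
Proof.
move=> mT; elim: zs x => [x ->|z zs IHzs x [t Bt xt]] /=; first by rewrite mulr0.
by exists (m * t); [exact: mT | rewrite -mulrA -mulrBr; exact: IHzs].
Qed.

Lemma comb_gen T zs t z : add_closed T -> z \in zs -> T t -> comb T zs (t * z).
Proof.
move=> hT + Tt; elim: zs => //= z' zs IHzs; rewrite inE => /predU1P[->|zzs].
  by exists t => //; rewrite subrr; exact: comb0.
by exists 0; [exact: hT.1 | rewrite mul0r subr0; exact: IHzs].
Qed.

Lemma comb_ann T zs u x : (forall t, T t -> u * t = t * u) ->
  (forall z, z \in zs -> u * z = 0) -> comb T zs x -> u * x = 0.
Proof.
move=> uT; elim: zs x => [x _ ->|z zs IHzs x uzs [t Tt xt]] /=; first by rewrite mulr0.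
have uxt : u * (x - t * z) = 0.
  by apply: IHzs xt => z' z'zs; apply: uzs; rewrite inE z'zs orbT.
by move: uxt; rewrite mulrBr mulrA (uT t Tt) -(mulrA t) (uzs z (mem_head _ _)) mulr0
    subr0.
Qed.

(** Elimination in place of a determinant: a common multiplier u in 1 + T is kept
    on the left, and removing the generator z multiplies it by u - t. *)
Lemma nakayama_ann T zs u : add_closed T ->
  (forall x y, T x -> T y -> T (x * y)) ->
  (forall x y, T x -> T y -> x * y = y * x) ->
  T (1 - u) -> (forall z, z \in zs -> comb T zs (u * z)) ->
  exists2 u', T (1 - u') & forall z, z \in zs -> u' * z = 0.
Proof.
move=> hT TM TC; elim: zs u => [|z zs IHzs] u Tu uzs; first by exists u.
have comm v t : T (1 - v) -> T t -> v * t = t * v.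
  move=> Tv Tt; have := TC _ _ Tv Tt.
  by rewrite mulrBl mulrBr mul1r mulr1 => /addrI/oppr_inj.
have one v w : T (1 - v) -> T (1 - w) -> T (1 - v * w).
  move=> Tv Tw; rewrite [X in T X](_ : _ = (1 - v) + (1 - w) - (1 - v) * (1 - w)).
    by apply: hT.2; [exact: add_closedD | exact: TM].
  have E : (1 - w) - (1 - v) * (1 - w) = v * (1 - w).
    by rewrite -[X in X - _]mul1r -mulrBl subKr.
  by rewrite -addrA E mulrBr mulr1 addrA addrNK.
have scale v t : T (1 - v) -> T t -> T (v * t).
  move=> Tv Tt; rewrite [X in T X](_ : _ = t - (1 - v) * t); last first.
    by rewrite mulrBl mul1r opprB addrC subrK.
  by apply: hT.2 => //; exact: TM.
have [t Tt ut] := uzs z (mem_head _ _).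
have Tut : T (1 - (u - t)) by rewrite opprB addrA addrAC; exact: add_closedD.
rewrite -mulrBl in ut.
have [z' z'zs|u' Tu' u'zs] := IHzs ((u - t) * u) (one _ _ Tut Tu).
  have := uzs z'; rewrite inE z'zs orbT => /(_ isT)[t' Tt' ut'].
  rewrite -mulrA -[u * z'](subrK (t' * z)) mulrDr; apply: combD => //.
    by apply: comb_scale ut' => s; exact: scale.
  rewrite mulrA (comm _ _ Tut Tt') -mulrA; apply: comb_scale ut => s; exact: TM.
exists (u' * (u - t)); first exact: one.
move=> z'; rewrite inE => /predU1P[->|z'zs].
  by rewrite -mulrA; apply: comb_ann ut => // s; exact: comm.
have -> : u' * (u - t) = (u - t) * u'.
  have := comm _ _ Tut Tu'; rewrite (mulrBr (u - t)) (mulrBl (u - t)) mulr1 mul1r.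
  by move=> /addrI/oppr_inj.
by rewrite -mulrA u'zs ?mulr0.
Qed.

(** If R is finitely generated over a commutative subring B and TR = R for an
    ideal T of B, then T = B: the multiplier of [nakayama_ann] annihilates R. *)
Lemma nakayama_unit B T zs (s : seq (R * R)) :
  add_closed B -> add_closed T -> T `<=` B ->
  (forall x y, B x -> B y -> x * y = y * x) ->
  (forall x b, T x -> B b -> T (x * b)) ->
  (forall x, comb B zs x) ->
  (forall p, p \in s -> T p.1) -> 1 = \sum_(p <- s) p.1 * p.2 -> T 1.
Proof.
move=> hB hT TB BC TM genB sT s1.
have [| | |u|u Tu uzs] := nakayama_ann (zs := zs) (u := 1) hT.
- by move=> x x' Tx Tx'; apply: TM => //; exact: TB.
- by move=> x x' Tx Tx'; apply: BC; exact: TB.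
- by rewrite subrr; exact: hT.1.
- move=> uzs; rewrite mul1r -[u]mul1r s1 mulr_suml; apply: comb_sum_mem => // p ps.
  by rewrite -mulrA; apply: comb_scale (genB _) => b Bb; apply: TM => //; exact: sT.
have /comb_ann : forall b, B b -> u * b = b * u.
  move=> b Bb; have := BC _ _ (TB _ Tu) Bb.
  by rewrite mulrBl mulrBr mul1r mulr1 => /addrI/oppr_inj.
move=> /(_ zs 1 uzs (genB 1)); rewrite mulr1 => u0.
by move: Tu; rewrite u0 subr0.
Qed.

End Nakayama.

(** * Normal Hopf subalgebras *)

Section NormalSubalgebra.
Variables (K : fieldType) (A H : hopfAlgType K) (iota : {lrmorphism A -> H}).
Hypothesis hn : normal_hopf_subalgebra iota.
Implicit Types (W : lmodType K) (a : A) (x y b h : H).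
Notation S := (antipode (s := H)).
Notation eps := (counit (s := H)).

Lemma lin_iota : lin iota.
Proof. by move=> a x y; rewrite linearP. Qed.
Local Hint Resolve lin_iota : core.

Lemma sw_sub W (F : H -> H -> W) a : bilin F ->
  sw F (iota a) = sw (fun u v => F (iota u) (iota v)) a.
Proof.
move=> bF; have [[_ Da _ _] _] := hn; rewrite /sw Da /tensor_map.
rewrite (lift_lin (g := tensor_lift F)); last by lin.
by apply: eq_lift => u v; rewrite liftE.
Qed.

(** Left normality lets elements of the subalgebra move to the left across any
    element of H. *)
Lemma commute_adl h y : h * y = sw (fun u v => ad_l u y * v) h.
Proof.
transitivity (sw (fun u v => sw (fun c d => c * y * S d * v) u) h); last first.
  by apply: eq_sw => u v; rewrite /ad_l (lift_lin (g := fun z => z * v)) //; lin.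
rewrite (sw_coassoc (f := fun c d v => c * y * S d * v)); [|lin..].
rewrite -(@sw_counitr _ _ _ (fun h => h * y) h); last by lin.
apply: eq_sw => c w.
rewrite [RHS](eq_sw (g := fun d v => c * y * (S d * v))); last first.
  by move=> d v; rewrite !mulrA.
by rewrite (sw_antipodel (g := fun z => c * y * z)) ?mulr1 //; lin.
Qed.

Lemma counit_adl h y : eps y = 0 -> eps (ad_l h y) = 0.
Proof.
move=> y0; rewrite /ad_l (lift_lin (X := K^o) (g := fun z => eps z));
    last exact: lin_counit.
by rewrite /tensor_lift big1 // => p _; rewrite !rmorphM /= y0 mulr0 mul0r.
Qed.

(** The right ideal IH of H. *)
Definition ext_ideal (I : set A) : set H := [set x | exists2 s : seq (A * H),
  forall p, p \in s -> I p.1 & x = \sum_(p <- s) iota p.1 * p.2].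

Lemma ext_ideal_gen I a h : I a -> ext_ideal I (iota a * h).
Proof.
by move=> Ia; exists [:: (a, h)]; [move=> p; rewrite inE => /eqP-> | rewrite big_seq1].
Qed.

Lemma ext_ideal_subspace I : subspace I -> subspace (ext_ideal I).
Proof.
move=> hI; split=> [|c x y [s sI ->] [r rI ->]]; first by exists [::]; rewrite ?big_nil.
exists ([seq (c *: p.1, p.2) | p <- s] ++ r).
  move=> p; rewrite mem_cat => /orP[/mapP[p' p's ->]|/rI//].
  by apply: subspaceZ => //; exact: sI.
rewrite big_cat big_map scaler_sumr; congr (_ + _); apply: eq_bigr => p _ /=.
by rewrite linearZ /= scalerAl.
Qed.

Lemma ext_ideal_ind I W (M : set W) (g : H -> W) x : subspace M -> lin g ->
  (forall a h, I a -> M (g (iota a * h))) -> ext_ideal I x -> M (g x).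
Proof.
move=> hM lg hg [s sI ->]; rewrite lin_sumE //.
by apply: subspace_sum_mem => // p ps; apply: hg; exact: sI.
Qed.

Lemma ext_ideal_mulr I x h : subspace I -> ext_ideal I x -> ext_ideal I (x * h).
Proof.
move=> hI; apply: (ext_ideal_ind (g := fun x => x * h)).
- exact: ext_ideal_subspace.
- by lin.
by move=> a h' Ia; rewrite -mulrA; exact: ext_ideal_gen.
Qed.

Lemma counit_sub a : eps (iota a) = counit a.
Proof. by case: hn => -[]. Qed.

Definition augmentation : set A := [set a | counit a = 0].

Lemma aug_subspace : subspace augmentation.
Proof.
split=> [|c x y]; rewrite /augmentation /= ?linear0 // => x0 y0.
by rewrite linearP /= x0 y0 mulr0 addr0.
Qed.

Notation q := (ext_ideal augmentation).

Lemma aug_split a : augmentation (a - (counit a)%:A).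
Proof. by rewrite /augmentation /= linearB linearZ /= rmorph1 mulr1 subrr. Qed.

Lemma aug_ideal_two_sided : two_sided_ideal q.
Proof.
have sM := ext_ideal_subspace aug_subspace; split; first exact: sM.1.
  by move=> x y; exact: subspaceD.
move=> h x qx; split; last exact: ext_ideal_mulr aug_subspace qx.
move: qx; apply: (ext_ideal_ind (g := fun x => h * x)) => //; first by lin.
move=> a h' a0; rewrite mulrA (commute_adl h (iota a)).
rewrite (sw_lin (g := fun z => z * h')); last by lin.
apply: subspace_sum => // p; have [_ st] := hn; have [[a' _ a'E] _] := st p.1 a.
rewrite -a'E -mulrA; apply: ext_ideal_gen; rewrite /augmentation /=.
by rewrite -counit_sub a'E counit_adl // counit_sub.
Qed.

Lemma tensor_sub_subspace (P Q : set H) : subspace P -> subspace (tensor_sub P Q).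
Proof.
move=> hP; split=> [|c x y [s sP ->] [r rP ->]]; first by exists [::]; rewrite ?big_nil.
exists ([seq (c *: p.1, p.2) | p <- s] ++ r).
  move=> p; rewrite mem_cat => /orP[/mapP[p' p's ->]|/rP//].
  by have [? ?] := sP _ p's; split=> //; exact: subspaceZ.
rewrite big_cat big_map scaler_sumr; congr (_ + _); apply: eq_bigr => p _ /=.
by rewrite pure_tensorZl.
Qed.

Lemma tensor_sub_pure (P Q : set H) x y : P x -> Q y -> tensor_sub P Q (x \ox y).
Proof.
by exists [:: (x, y)]; [move=> p; rewrite inE => /eqP-> | rewrite big_seq1].
Qed.

(** The coproduct of a h with eps(a) = 0 is the sum of the
    (a1 - eps(a1)) h1 (x) a2 h2 and of h1 (x) a h2. *)
Lemma aug_ideal_hopf : hopf_ideal q.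
Proof.
have iq := aug_ideal_two_sided; have sq := ideal_subspace iq.
have sT : subspace (@setT H) by [].
split=> //.
- pose M : set (tensor H H) := [set z | exists z1 z2,
    [/\ tensor_sub q setT z1, tensor_sub setT q z2 & z = z1 + z2]].
  have hM : subspace M.
    have sql := tensor_sub_subspace setT sq.
    have sqr := tensor_sub_subspace q sT.
    split; first by exists 0, 0; rewrite addr0; split=> //; [exact: sql.1|exact: sqr.1].
    move=> c _ _ [x1 [x2 [x1q x2q ->]]] [y1 [y2 [y1q y2q ->]]].
    exists (c *: x1 + y1), (c *: x2 + y2); rewrite scalerDr addrACA.
    by split=> //; [exact: sql.2 | exact: sqr.2].
  move=> x; apply: (ext_ideal_ind (M := M)) => //; first exact: lin_comul.
  move=> a h a0; rewrite comulE swM; last by lin.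
  rewrite sw_sub; last by lin.
  exists (sw (fun r s => sw (fun u v =>
     (iota (r - (counit r)%:A) * u) \ox (iota s * v)) h) a).
  exists (sw (fun u v => u \ox (iota a * v)) h); split.
  + apply: subspace_sum => [|p]; first exact: tensor_sub_subspace.
    apply: subspace_sum => [|p']; first exact: tensor_sub_subspace.
    by apply: tensor_sub_pure => //; apply: ext_ideal_gen; exact: aug_split.
  + apply: subspace_sum => [|p]; first exact: tensor_sub_subspace.
    by apply: tensor_sub_pure => //; apply: ext_ideal_gen.
  rewrite -[X in _ + X](@sw_counitl _ _ _ (fun a => sw (fun u v => u \ox (iota a * v))
      h)); last by lin.
  rewrite -[RHS]big_split; apply: eq_bigr => p _ /=.
  rewrite /sw /tensor_lift scaler_sumr -big_split; apply: eq_bigr => p' _ /=.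
  by rewrite -pure_tensorZl -pure_tensorDl linearB linearZ rmorph1 /= mulrBl -scalerAl
      mul1r subrK.
- move=> x; apply: (ext_ideal_ind (M := [set (0 : K^o)]) (g := fun x => eps x : K^o)).
  + exact: subspace0.
  + by lin.
  by move=> a h a0; rewrite rmorphM /= counit_sub a0 mul0r.
move=> x; apply: (ext_ideal_ind (g := fun x => S x)) => //; first by lin.
move=> a h a0; rewrite antipodeM; have [[_ _ _ ->] _] := hn.
have [_ _ /(_ (S h) (iota (antipode a) * 1) _)[|//]] := iq; last by rewrite mulr1.
by apply: ext_ideal_gen; rewrite /augmentation /= counit_antipode.
Qed.

Lemma add_closed_range : add_closed (range iota).
Proof.
split; first by exists 0; rewrite ?linear0.
by move=> _ _ [x _ <-] [y _ <-]; exists (x - y); rewrite ?linearB.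
Qed.

(** From a right generating family to a left one, by moving A to the left with
    [commute_adl]. *)
Lemma left_fin_gen : fin_gen_right_module iota ->
  exists fs : seq H, forall h, comb (range iota) fs h.
Proof.
move=> [n [e eP]].
exists (flatten [seq [seq p.2 | p <- repr (comul (e i))] | i <- enum 'I_n]) => h.
have hR := add_closed_range.
have [a ->] := eP h; apply: comb_sum => // i; rewrite commute_adl.
apply: comb_sum_mem => // p ps; have [_ st] := hn; have [aE _] := st p.1 (a i).
apply: comb_gen => //; apply/flattenP.
exists [seq p.2 | p <- repr (comul (e i))]; last exact: map_f.
by apply: (map_f (fun i => [seq p.2 | p <- repr (comul (e i))])); rewrite mem_enum.
Qed.

Lemma ext_ideal_finite_codim I (fs : seq H) : subspace I -> finite_codim I ->
  (forall h, comb (range iota) fs h) -> finite_codim (ext_ideal I).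
Proof.
move=> hI [m [g gP]] fsP.
suff [n [e eP]] : exists n (e : 'I_n -> H), forall h, comb (range iota) fs h ->
    exists c : 'I_n -> K, ext_ideal I (h - \sum_i c i *: e i).
  by exists n, e => h; apply: eP.
elim: fs {fsP} => [|f fs [n [e eP]]].
  exists 0, (fun=> 0) => h /= ->; exists (fun=> 0); rewrite big_ord0 subr0.
  exact: (ext_ideal_subspace hI).1.
exists (m + n)%N, (fun i => match split i with inl k => iota (g k) * f | inr j => e j
    end).
move=> h /= [_ [a _ <-]] /eP[c cP]; have [d dP] := gP a.
exists (fun i => match split i with inl k => d k | inr j => c j end).
set Z := \sum_(i < m + n) _.
have -> : Z = \sum_i d i *: (iota (g i) * f) + \sum_i c i *: e i.
  rewrite /Z big_split_ord; congr (_ + _); apply: eq_bigr => i _.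
    by rewrite -[lshift n i]/(unsplit (inl i)) unsplitK.
  by rewrite -[rshift m i]/(unsplit (inr i)) unsplitK.
rewrite [X in ext_ideal I X](_ : _ = iota (a - \sum_i d i *: g i) * f +
    (h - iota a * f - \sum_i c i *: e i)).
  apply: subspaceD => //; first exact: ext_ideal_subspace.
  exact: ext_ideal_gen.
rewrite linearB mulrBl linear_sum mulr_suml /=.
rewrite [X in _ = _ - X + _](eq_bigr (fun i => d i *: (iota (g i) * f))); last first.
  by move=> i _; rewrite linearZ /= scalerAl.
move: (\sum_i _ *: (_ * _)) (\sum_i _ *: e i) => X Y.
rewrite opprD addrA [RHS]addrA; congr (_ + _).
by rewrite [RHS]addrC addrA addrNK.
Qed.

Lemma aug_finite_codim : finite_codim augmentation.
Proof.
by exists 1, (fun=> 1) => a; exists (fun=> counit a); rewrite big_ord1;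
    exact: aug_split.
Qed.

Lemma sub_coinv a : coinv q (iota a).
Proof.
move=> f [lf f0]; rewrite /hit sw_sub; last by lin.
rewrite -[in RHS](@sw_counitr _ _ _ (fun a => a) a) //.
rewrite (sw_lin (g := fun z => (f 1 : K) *: iota z)); last by lin.
apply: eq_sw => u v; rewrite linearZ /= scalerA; congr (_ *: _).
have := f0 _ (ext_ideal_gen 1 (aug_split v)).
rewrite mulr1 linearB linearZ rmorph1 /= linB // linZ // => /subr0_eq ->.
by rewrite [LHS]mulrC.
Qed.

(** In other words b (x) 1 = 1 (x) b in the tensor product over A. The map
    G(x, y) = F(x S(y1), y2) kills q in y, because S(a1 h1) (x) a2 h2 becomes
    S(h1) S(a1) a2 (x) h2 over A. So G(b1, b2) can be computed with b coinvariant,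
    which gives F(b, 1), or with the antipode axiom, which gives F(1, b). *)
Lemma coinv_balanced W (F : H -> H -> W) b : finite_codim q -> bilin F ->
  (forall x a y, F (x * iota a) y = F x (iota a * y)) ->
  coinv q b -> F b 1 = F 1 b.
Proof.
move=> fq bF balF hb; have hq := aug_ideal_hopf; have [iq _ _ _] := hq.
have [n [e [c [dc ec]]]] := finite_codim_dual (ideal_subspace iq) fq.
have [lc c0 _] := dc.
pose G x y := sw (fun u v => F (x * S u) v) y.
have lG x : lin (G x) by rewrite /G; lin.
have lG' y : lin (G^~ y) by rewrite /G; lin.
have G0 x y : q y -> G x y = 0.
  apply: (ext_ideal_ind (M := [set (0 : W)])) => //; first exact: subspace0.
  move=> a h a0; rewrite /= /G swM; last by lin.
  rewrite sw_sub; last by lin.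
  rewrite /sw /tensor_lift exchange_big big1 // => p _.
  rewrite -[LHS]/(sw (fun u v => F (x * S (iota u * p.1)) (iota v * p.2)) a).
  rewrite (eq_sw (g := fun u v => F (x * S p.1 * iota (antipode u * v)) p.2)).
    rewrite (sw_antipodel (g := fun z => F (x * S p.1 * iota z) p.2)); last by lin.
    by rewrite a0 scale0r.
  move=> u v; rewrite antipodeM; have [[_ _ _ ->] _] := hn.
  by rewrite -balF rmorphM !mulrA.
transitivity (sw G b).
  transitivity (sw (fun u v => \sum_i (c i v : K) *: G u (e i)) b); last first.
    by apply: eq_sw => u v; rewrite (dual_expand ec _ (lG u) (G0 u)).
  rewrite sw_sum; transitivity (\sum_i (c i 1 : K) *: G b (e i)).
    by rewrite (dual_expand ec _ (lG b) (G0 b)) /G sw1 ?antipode1 ?mulr1 //; lin.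
  apply: eq_bigr => i _; rewrite -(linZ (lG' _)) -hb; last by split=> //; exact: c0.
  rewrite /hit (sw_lin (g := fun z => G z (e i))) //.
  by apply: eq_sw => u v; rewrite (linZ (lG' _)).
rewrite /G -(sw_coassoc (f := fun u p r => F (u * S p) r)); [|lin..].
rewrite -(@sw_counitl _ _ _ (fun r => F 1 r) b); last by lin.
by apply: eq_sw => w r; rewrite (sw_antipoder (g := fun z => F z r)) //; lin.
Qed.

(** For c in the centralizer of A the form x c y is balanced, so c commutes with
    B. Taking c in A shows that B lies in that centralizer; then take c in B. *)
Lemma coinv_commutative b b' : finite_codim q ->
  commutative (fun a b : A => a * b) ->
  coinv q b -> coinv q b' -> b * b' = b' * b.
Proof.
move=> fq cA hb hb'.
have comm c : (forall a, c * iota a = iota a * c) ->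
    forall d, coinv q d -> d * c = c * d.
  move=> cc d hd; have := @coinv_balanced H (fun x y => x * c * y) d fq.
  rewrite mulr1 mul1r; apply=> //; first by lin.
  by move=> x a y; rewrite -!mulrA (mulrA c) cc !mulrA.
apply: (comm _ _ _ hb) => a; apply: (comm _ _ _ hb') => a'.
by rewrite -!rmorphM; congr (iota _); exact: cA.
Qed.

End NormalSubalgebra.

(** * Commutative Hopf subalgebras of finite index *)

Section CommutativeCase.
Variables (K : fieldType) (A H : hopfAlgType K) (iota : {lrmorphism A -> H}).
Hypothesis hn : normal_hopf_subalgebra iota.
Hypothesis cA : commutative (fun a b : A => a * b).
Hypothesis fgH : fin_gen_right_module iota.
Implicit Types (a : A) (x y b h : H).
Local Hint Resolve lin_iota : core.
Notation q := (ext_ideal iota (@augmentation K A)).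

Let hq : hopf_ideal q. Proof. exact: aug_ideal_hopf. Qed.
Let iq : two_sided_ideal q. Proof. by case: hq. Qed.

Lemma aug_ideal_finite_codim : finite_codim q.
Proof.
have [fs fsP] := left_fin_gen hn fgH.
exact: ext_ideal_finite_codim (aug_subspace A) (aug_finite_codim A) fsP.
Qed.
Let fq := aug_ideal_finite_codim.

(** The left module homomorphisms from H to the coinvariants. *)
Definition coinv_linear (r : H -> H) : Prop :=
  [/\ lin r, forall h, coinv q (r h) &
      forall b h, coinv q b -> r (b * h) = b * r h].

(** The values at 1 of the homomorphisms from H to B form an ideal T of B, which
    contains the phi_k(1). As 1 = sum_k phi_k(1) z_k, we have TH = H. *)
Lemma coinv_retraction : exists2 r, coinv_linear r & r 1 = 1.
Proof.
have [N [phi [z [lphi phiB phiM phiz _]]]] := coinv_frame_exists hq fq.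
have sB := coinv_subspace q.
have hB : add_closed (coinv q) by split=> [|x y]; [exact: sB.1 | exact: subspaceB].
pose T := [set x | exists2 r, coinv_linear r & r 1 = x].
suff : T 1 by [].
apply: (@nakayama_unit H (coinv q) T (codom z) [seq (phi k 1, z k) | k <- enum 'I_N])
    => //.
- split=> [|_ _ [r [lr rB rM] <-] [s [ls sB' sM] <-]].
    exists (fun=> 0) => //; split=> [a x y|h|b h _]; last by rewrite mulr0.
      by rewrite scaler0 addr0.
    exact: sB.1.
  exists (fun h => r h - s h) => //; split=> [|h|b h hb]; first by lin.
    exact: (subspaceB sB (rB h) (sB' h)).
  by rewrite rM // sM // mulrBr.
- by move=> _ [r [_ rB _] <-].
- by move=> x y; exact: (coinv_commutative hn fq cA).
- move=> _ b [r [lr rB rM] <-] hb; exists (fun h => r h * b) => //.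
  split=> [|h|b' h hb']; first by lin.
    exact: (coinvM iq (rB h) hb).
  by rewrite rM // mulrA.
- move=> x; rewrite (phiz x); apply: comb_sum => // k.
  by apply: comb_gen => //; exact: codom_f.
- by move=> _ /mapP[k _ ->]; exists (phi k) => //; split;
    [exact: lphi | exact: phiB | exact: phiM].
by rewrite big_map /= big_enum /=; exact: phiz.
Qed.

(** The left ideal HI of H. *)
Definition right_ext (I : set A) : set H := [set x | exists2 s : seq (A * H),
  forall p, p \in s -> I p.1 & x = \sum_(p <- s) p.2 * iota p.1].

Lemma right_ext_subspace I : subspace I -> subspace (right_ext I).
Proof.
move=> hI; split=> [|c x y [s sI ->] [r rI ->]]; first by exists [::]; rewrite ?big_nil.
exists ([seq (c *: p.1, p.2) | p <- s] ++ r).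
  move=> p; rewrite mem_cat => /orP[/mapP[p' p's ->]|/rI//].
  by apply: subspaceZ => //; exact: sI.
rewrite big_cat big_map scaler_sumr; congr (_ + _); apply: eq_bigr => p _ /=.
by rewrite linearZ /= scalerAr.
Qed.

(** [nakayama_unit] in the opposite ring of H, where right multiplication by A
    is left multiplication. *)
Lemma right_ext_proper (I : set A) : two_sided_ideal I -> right_ext I 1 -> I 1.
Proof.
move=> iI [s sI s1]; have sI' := ideal_subspace iI; have [_ _ IM] := iI.
have [injA _ _ _] := hn.1.
have [n [e eP]] := fgH.
suff [a Ia a1] : (iota @` I) 1 by rewrite -(injA a 1) ?rmorph1.
apply: (@nakayama_unit H^c (range iota) (iota @` I) (codom e)
  [seq (iota p.1, p.2) | p <- s]).
- exact: add_closed_range.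
- split; first by exists 0; [exact: sI'.1 | rewrite linear0].
  move=> _ _ [a Ia <-] [a' Ia' <-]; exists (a - a'); last by rewrite linearB.
  exact: subspaceB.
- by move=> _ [a _ <-]; exists a.
- move=> _ _ [a _ <-] [a' _ <-].
  by rewrite -[LHS](rmorphM iota a' a) -[RHS](rmorphM iota a a'); congr (iota _);
      exact: cA.
- move=> _ _ [a Ia <-] [a' _ <-]; exists (a' * a); first exact: (IM a' a Ia).1.
  by rewrite rmorphM.
- move=> x; have [a ->] := eP x; apply: comb_sum => [|k]; first exact: add_closed_range.
  rewrite -[e k * _]/((iota (a k) : H^c) * e k).
  apply: comb_gen; [exact: add_closed_range | exact: codom_f | by exists (a k)].
- by move=> _ /mapP[p ps ->]; exists p.1 => //; exact: sI.
by rewrite big_map.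
Qed.

(** The coinvariants are generated over A by 1 and the images of generators of H
    under a retraction r. N gs is the A-module spanned by 1 and gs. To drop a
    generator g, let I be the ideal of the a with a g in N gs. If 1 is not in HI,
    take a functional l that kills HI with l(1) = 1, and let al(y) be a
    coefficient of g in r(y), well defined modulo I. The form l(x al(y)) is
    balanced, is 0 at (g, 1) and 1 at (1, g), against [coinv_balanced]. *)
Lemma coinv_sub b : coinv q b -> range iota b.
Proof.
have [r [lr rB rM] r1] := coinv_retraction.
have rb b' : coinv q b' -> r b' = b' by move=> hb'; rewrite -[b']mulr1 rM // r1.
have [fs fsP] := left_fin_gen hn fgH.
have hR := add_closed_range iota.
have rA a : r (iota a) = iota a by apply: rb; exact: sub_coinv.
pose N gs x := exists a, comb (range iota) gs (x - iota a).
have scaleN gs a x : N gs x -> N gs (iota a * x).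
  move=> [a' xa']; exists (a * a'); rewrite rmorphM -mulrBr.
  by apply: comb_scale xa' => _ [a'' _ <-]; exists (a * a''); rewrite ?rmorphM.
have subN gs : subspace (N gs).
  split=> [|c x y /(scaleN _ (c%:A)) [a xa] [a' ya']].
    by exists 0; rewrite linear0 subr0; exact: comb0.
  exists (a + a'); rewrite linearD opprD addrACA; apply: combD => //.
  by move: xa; rewrite linearZ rmorph1 /= -scalerAl mul1r.
have iotaN gs a : N gs (iota a) by exists a; rewrite subrr; exact: comb0.
suff main gs : (forall g, g \in gs -> coinv q g) ->
    (forall b, coinv q b -> N gs b) -> forall b, coinv q b -> range iota b.
  apply: (main (map r fs)) => [_ /mapP[f _ ->]//|b' hb'].
  exists 0; rewrite linear0 subr0 -(rb _ hb').
  have := fsP b'; clear -hR lr rM hn; elim: fs b' => [b' /= ->|f fs IHfs b' /= [_ [a _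
      <-] h]].
    by rewrite lin0.
  exists (iota a); first by exists a.
  by rewrite -rM -?linB //; [exact: IHfs | exact: sub_coinv].
elim: gs => [_ BN b' /BN[a /= /subr0_eq ->]|g gs IHgs gB BN]; first by exists a.
have hg : coinv q g by apply: gB; rewrite mem_head.
have split_g b' : coinv q b' -> exists a, N gs (b' - iota a * g).
  by move=> /BN[a /= [_ [a' _ <-]]]; exists a', a; rewrite addrAC.
pose I a := N gs (iota a * g).
have iI : two_sided_ideal I.
  split=> [|a a' Ia Ia'|a' a Ia]; rewrite /I.
  - by rewrite linear0 mul0r; exact: (subN gs).1.
  - by rewrite linearD mulrDl; exact: subspaceD.
  have Ia'a : N gs (iota (a' * a) * g) by rewrite rmorphM -mulrA; exact: scaleN.
  by split=> //; rewrite cA.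
apply: IHgs => [g' g'gs|b' /split_g[a Na]]; first by apply: gB; rewrite inE g'gs orbT.
rewrite -(subrK (iota a * g) b'); apply: subspaceD => //.
suff I1 : I 1 by apply: scaleN; move: I1; rewrite /I rmorph1 mul1r.
apply: right_ext_proper => //; apply: contrapT => nI1.
have [l [ll lI l1]] := separation (right_ext_subspace (ideal_subspace iI)) nI1.
have lE w a1 a2 x : N gs (w - iota a1 * g) -> N gs (w - iota a2 * g) ->
    l (x * iota a1) = l (x * iota a2).
  move=> N1 N2; apply: subr0_eq; rewrite -linB // -mulrBr -linearB; apply: lI.
  exists [:: (a1 - a2, x)]; last by rewrite big_seq1.
  move=> p; rewrite inE => /eqP-> /=; rewrite /I linearB mulrBl.
  have := subspaceB (subN gs) N2 N1.
  by rewrite opprB addrC addrA addrNK.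
have [al alP] : exists al : H -> A, forall y, N gs (r y - iota (al y) * g).
  exists (fun y => projT1 (cid (split_g _ (rB y)))) => y.
  exact: (projT2 (cid (split_g _ (rB y)))).
have := @coinv_balanced K A H iota hn K^o (fun x y => l (x * iota (al y)) : K^o) g fq.
rewrite (lE (r 1) (al 1) 0 g); last 2 first.
- exact: alP.
- by rewrite r1 linear0 mul0r subr0 -(rmorph1 iota); exact: iotaN.
rewrite (lE (r g) (al g) 1 1); last 2 first.
- exact: alP.
- by rewrite rb // rmorph1 mul1r subrr; exact: (subN gs).1.
rewrite linear0 mulr0 lin0 // rmorph1 mulr1 l1 => bal.
suff /eqP : (0 : K) = 1 by rewrite eq_sym oner_eq0.
apply: bal => //.
- split=> [y|x c y y']; first by lin.
  rewrite (lE (r (c *: y + y')) _ (c *: al y + al y')) //; last first.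
    rewrite lr linearP mulrDl opprD addrACA -scalerAl -scalerBr.
    by apply: (subN gs).2.
  by rewrite linearP mulrDr -scalerAr ll.
move=> x a1 y; rewrite (lE (r (iota a1 * y)) (al (iota a1 * y)) (a1 * al y)) //.
  by rewrite rmorphM mulrA.
rewrite rM; last exact: sub_coinv.
by rewrite rmorphM -mulrA -mulrBr; exact: scaleN.
Qed.

(** A retraction onto A maps IH to I and fixes A. *)
Lemma ext_ideal_contract I a : two_sided_ideal I -> ext_ideal iota I (iota a) -> I a.
Proof.
move=> iI Ia; have sI := ideal_subspace iI; have [_ _ IM] := iI.
have [injA _ _ _] := hn.1.
have [r [lr rB rM] r1] := coinv_retraction.
have [a' Ia' a'E] : (iota @` I) (r (iota a)).
  apply: (ext_ideal_ind (M := iota @` I)) Ia => //.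
    split; first by exists 0; [exact: sI.1 | rewrite linear0].
    move=> c _ _ [u Iu <-] [v Iv <-]; exists (c *: u + v); last by rewrite linearP.
    exact: sI.2.
  move=> u h Iu; rewrite rM; last exact: sub_coinv.
  have [v _ <-] := coinv_sub (rB h); exists (u * v); last by rewrite rmorphM.
  exact: (IM v u Iu).2.
rewrite -(injA a' a) // a'E -[iota a in LHS]mulr1 rM; last exact: sub_coinv.
by rewrite r1 mulr1.
Qed.

Lemma hopf_ideal_meet J : hopf_ideal J -> hopf_ideal (iota @^-1` J).
Proof.
move=> [iJ JD J0 JS]; have [J00 JDD JM] := iJ; have [[_ Da ea Sa] _] := hn.
split.
- split=> [|x y Jx Jy|h x Jx]; rewrite /preimage /=.
  + by rewrite linear0.
  + by rewrite linearD; exact: JDD.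
  by rewrite !rmorphM; exact: JM.
- move=> a Ja; have [z1 [z2 [z1J z2J zE]]] := JD _ Ja.
  rewrite Da in zE.
  exact: (tensor_kernel (@lin_iota _ _ _ iota) (ideal_subspace iJ) z1J z2J zE).
- by move=> a Ja; rewrite -ea; exact: J0.
by move=> a Ja; rewrite /preimage /= -Sa; exact: JS.
Qed.

(** Expand an element of J in a frame: its coordinates lie in J and in A. *)
Lemma hopf_ideal_eq0 J : hopf_ideal J -> J `<=` q ->
  (forall a, J (iota a) -> a = 0) -> J `<=` [set 0].
Proof.
move=> hJ Jq JA x Jx.
have [N [phi [z [_ phiB _ phiz phiJ]]]] := coinv_frame_exists hq fq.
rewrite /= (phiz x) big1 // => k _.
have := phiJ J hJ Jq k x Jx; have [a _ <-] := coinv_sub (phiB k x).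
by move=> /JA ->; rewrite linear0 mul0r.
Qed.

(** With e'_j spanning H modulo R, the condition Hx inside R only has to be
    checked on the products e'_j x. *)
Lemma core_finite_codim (R : set H) : subspace R ->
  (forall x h, R x -> R (x * h)) -> finite_codim R ->
  finite_codim [set x | q x /\ forall h, R (h * x)].
Proof.
move=> sR RM fR; have sq := ideal_subspace iq.
have [n [e [c [[lc c0 _] ec]]]] := finite_codim_dual sq fq.
have [m [e' [c' [[lc' c0' _] ec']]]] := finite_codim_dual sR fR.
pose d (k : 'I_n + 'I_m * 'I_m) : H -> K^o :=
  match k with inl i => c i | inr ij => fun x => c' ij.1 (e' ij.2 * x) end.
have ld k : lin (d k) by case: k => [i|ij] /=; lin.
have [N [g gP]] := finite_codim_kernels ld.
exists N, g => h; have [a aP] := gP h; exists a; move: (h - _) aP => x /= dx.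
have memR y : (forall i, c' i y = 0) -> R y.
  move=> y0; have := ec' y; rewrite /fproj big1 ?subr0 // => i _.
  by rewrite y0 scale0r.
split.
  have := ec x; rewrite /fproj big1 ?subr0 // => i _.
  by rewrite [c i x](dx (inl i)) scale0r.
move=> h'; apply: memR => i.
rewrite -(subrK (fproj e' c' h') h') mulrDl (linD (lc' i)) c0'; last exact: RM.
rewrite add0r /fproj mulr_suml (lin_sumE _ _ (lc' i)) big1 // => j _.
by rewrite -scalerAl (linZ (lc' i)) [c' i _](dx (inr (i, j))) scaler0.
Qed.

Lemma inner_linear_extension : inner_linear A -> inner_linear H.
Proof.
move=> [I [iI fI maxI]]; have sI := ideal_subspace iI.
have [fs fsP] := left_fin_gen hn fgH.
have sE := ext_ideal_subspace iota sI.
have sq := ideal_subspace iq; have [_ _ qM] := iq.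
exists [set x | q x /\ forall h, ext_ideal iota I (h * x)]; split.
- split=> [|x y [qx Ex] [qy Ey]|h x [qx Ex]].
  + by split=> [|h]; [exact: sq.1 | rewrite mulr0; exact: sE.1].
  + by split=> [|h]; [exact: subspaceD | rewrite mulrDr; exact: subspaceD].
  split; split=> [|h'].
  * exact: (qM h x qx).1.
  * by rewrite mulrA.
  * exact: (qM h x qx).2.
  by rewrite mulrA; apply: ext_ideal_mulr.
- apply: core_finite_codim => //.
    by move=> x h; exact: ext_ideal_mulr.
  exact: ext_ideal_finite_codim sI fI fsP.
move=> J hJ JE; apply: hopf_ideal_eq0 => // [x /JE[]//|a Ja].
apply: (maxI _ (hopf_ideal_meet hJ)) => // a' /JE[_ /(_ 1)].
by rewrite mul1r; exact: ext_ideal_contract.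
Qed.

End CommutativeCase.

Theorem theorem4p1 (R : realType) (H A : hopfAlgType R[i])
    (iota : {lrmorphism A -> H}) :
  normal_hopf_subalgebra iota ->
  inner_linear A ->
  commutative (fun a b : A => a * b) ->
  fin_gen_right_module iota ->
  inner_linear H.
Proof. by move=> hn hA cA fg; exact: (inner_linear_extension hn cA fg hA). Qed.
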